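(* For every pair $a,b\in\{1,\dots,M\}$, every finite minor of the Hankel matrix \[ \bigl[m_{r+c}^{a,b}\bigr]_{r,c\ge0} \] is a polynomial with nonnegative integer coefficients in the nontrivial entries of the refactorized bidiagonal factors. For strictly positive numerical factors, the leading Hankel determinants and their one-step shifts satisfy \[ \det\bigl[m_{r+c}^{a,b}\bigr]_{r,c=0}^{k-1}>0,\qquad \det\bigl[m_{r+c+1}^{a,b}\bigr]_{r,c=0}^{k-1}>0 \] for every $k\ge1$. Consequently, there is a positive measure $\mathrm d\rho^{a,b}$ on $[0,\infty)$, with infinite support, such that \[ m_k^{a,b}=\int_{[0,\infty)}x^k\,\mathrm d\rho^{a,b}(x),\qquad k\in\mathbb N_0 . \] If the refactorized factor coefficients are uniformly bounded, every representing measure is compactly supported and the measure is unique.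
   Context: Let $p,q\ge1$, $M=p+q$, $d=\gcd(p,q)$, $P=p/d$, $Q=q/d$, $R=P+Q$. Matrices are semi-infinite, indexed by $\mathbb N_0$. A lower bidiagonal $L$ is normalized if $L_{n,n}=1$ (nontrivial entries, or coefficients, $L_{n+1,n}$); an upper bidiagonal $U$ is normalized if $U_{n,n+1}=1$ (nontrivial entries $U_{n,n}$); positive means all nontrivial entries are $>0$. Let $T=L_1\cdots L_pU_q\cdots U_1$ be a positive bidiagonal factorization (all factors normalized positive), $F_a=L_a$ ($1\le a\le p$), $F_{p+b}=U_{q-b+1}$ ($1\le b\le q$). Fix an index $a_0\in\{a_-,\dots,a_+\}$, where $a_-=p-\lceil P/Q\rceil+1$ and $a_+=p+1+\min\{q-1,\lceil Q/P\rceil\}$. Let $r_k$ be the remainder of $kQ$ modulo $R$ and $\sigma_{\mathrm{min}}$ the word of length $M$ whose $(k+1)$-st letter is $L$ if $r_k<P$ and $U$ if $r_k\ge P$. Finitely many replacements of a neighbouring pair $U,L$ (upper immediately before lower) by the unique normalized positive lower--upper pair $\widetilde L,\widetilde U$ with $UL=\widetilde L\widetilde U$ transform the list $(F_{a_0},\dots,F_M,F_1,\dots,F_{a_0-1})$ into a list $(\widetilde F_1,\dots,\widetilde F_M)$ of normalized positive bidiagonal factors whose type word is $\sigma_{\mathrm{min}}$ (the result is independent of the chosen replacements). These are the refactorized bidiagonal factors; they contain $p$ lower and $q$ upper factors. For $a\in\{1,\dots,M\}$ put $\widetilde T_{(a)}=\widetilde F_a\cdots\widetilde F_M\widetilde F_1\cdots\widetilde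 F_{a-1}$. For $a,b\in\{1,\dots,M\}$ let $s(a,b)\in\{0,\dots,M-1\}$ satisfy $b\equiv a+s(a,b)\pmod M$, and let $\widetilde F_{a\to b}=\widetilde F_a\widetilde F_{a+1}\cdots$ be the product of $s(a,b)$ consecutive factors starting with $\widetilde F_a$, indices read cyclically (the identity if $a=b$). Define $m_k^{a,b}=\bigl(\widetilde F_{a\to b}(\widetilde T_{(b)})^k\bigr)_{0,0}=\bigl((\widetilde T_{(a)})^k\widetilde F_{a\to b}\bigr)_{0,0}$, $k\in\mathbb N_0$ (the two expressions coincide). *)

(* Defs.v *)
From HB Require Import structures.
From mathcomp Require Import all_boot all_order all_algebra.
From mathcomp Require Import all_classical all_reals all_analysis.
From mathcomp Require mpoly.
From Stdlib Require Export Relation_Operators.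

Set Implicit Arguments.
Unset Strict Implicit.
Unset Printing Implicit Defensive.

Import Order.TTheory GRing.Theory Num.Theory numFieldNormedType.Exports.

Local Open Scope classical_set_scope.
Local Open Scope ring_scope.

(* Semi-infinite matrices, indexed by nat * nat. *)
Definition smatrix (A : Type) := nat -> nat -> A.

(* The sum has finite support whenever M has finite rows, which is the case for
   every product and power of bidiagonal matrices. *)
Definition smulmx (A : comNzRingType) (M N : smatrix A) : smatrix A :=
  fun i j => \sum_(k \in [set: nat]) M i k * N k j.

Definition smx1 (A : comNzRingType) : smatrix A := fun i j => (i == j)%:R.

Definition smxexp (A : comNzRingType) (M : smatrix A) (k : nat) : smatrix A :=
  iter k (smulmx M) (smx1 A).

(* A normalized bidiagonal matrix, given by its nontrivial entries:
   Lower l has entries l n in position (n+1, n) and ones on the diagonal,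
   Upper u has entries u n in position (n, n) and ones in positions (n, n+1). *)
Inductive bidiag (A : Type) : Type :=
  | Lower of (nat -> A)
  | Upper of (nat -> A).

Definition is_lower (A : Type) (F : bidiag A) : bool :=
  if F is Lower _ then true else false.

Definition coeffs (A : Type) (F : bidiag A) : nat -> A :=
  match F with Lower l => l | Upper u => u end.

Definition mx_of_bidiag (A : comNzRingType) (F : bidiag A) : smatrix A :=
  match F with
  | Lower l => fun i j => (i == j)%:R + l j *+ (i == j.+1)
  | Upper u => fun i j => u i *+ (i == j) + (j == i.+1)%:R
  end.

Definition bidiag_prod (A : comNzRingType) (s : seq (bidiag A)) : smatrix A :=
  foldr (fun F N => smulmx (mx_of_bidiag F) N) (smx1 A) s.

(* Words in the letters L (true) and U (false). *)
Definition type_word (A : Type) (s : seq (bidiag A)) : seq bool :=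
  map (@is_lower A) s.

Definition coef (A : comNzRingType) (s : seq (bidiag A)) (i n : nat) : A :=
  coeffs (nth (Lower (fun=> 0)) s i) n.

Definition positive_seq (R : realType) (x : nat -> R) : Prop :=
  forall n, 0 < x n.

(* The list L_1, ..., L_p, U_q, ..., U_1; the ordinal i stands for index i + 1. *)
Definition factor_list (A : Type) (p q : nat)
    (L : 'I_p -> nat -> A) (U : 'I_q -> nat -> A) : seq (bidiag A) :=
  [seq Lower (L i) | i <- enum 'I_p] ++
  [seq Upper (U (rev_ord i)) | i <- enum 'I_q].

Definition positive_bidiagonal_factorization (R : realType) (p q : nat)
    (T : smatrix R) (L : 'I_p -> nat -> R) (U : 'I_q -> nat -> R) : Prop :=
  [/\ forall i, positive_seq (L i), forall i, positive_seq (U i) &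
      T = bidiag_prod (factor_list L U)].

Definition ceil_div (m n : nat) : nat := ((m + n).-1 %/ n)%N.

Definition redl (p q : nat) : nat := (p %/ gcdn p q)%N.
Definition redr (p q : nat) : nat := (q %/ gcdn p q)%N.

Definition a_minus (p q : nat) : nat :=
  (p - ceil_div (redl p q) (redr p q) + 1)%N.

Definition a_plus (p q : nat) : nat :=
  (p + 1 + minn (q - 1) (ceil_div (redr p q) (redl p q)))%N.

Definition sigma_min (p q : nat) : seq bool :=
  mkseq (fun k => ((k * redr p q) %% (redl p q + redr p q) < redl p q)%N) (p + q).

Inductive refactor_step (R : realType) :
    seq (bidiag R) -> seq (bidiag R) -> Prop :=
  RefactorStep (s1 s2 : seq (bidiag R)) (u l l' u' : nat -> R) of
    positive_seq l' & positive_seq u' &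
    smulmx (mx_of_bidiag (Upper u)) (mx_of_bidiag (Lower l)) =
    smulmx (mx_of_bidiag (Lower l')) (mx_of_bidiag (Upper u')) :
  refactor_step (s1 ++ [:: Upper u, Lower l & s2])
                (s1 ++ [:: Lower l', Upper u' & s2]).

(* Indices of factors (a0, a, b below) are the 1-based ones, so that the
   cyclic list starting with the a-th factor is rot a.-1. *)
Definition refactorized (R : realType) (p q : nat)
    (L : 'I_p -> nat -> R) (U : 'I_q -> nat -> R) (a0 : nat)
    (Ft : seq (bidiag R)) : Prop :=
  clos_refl_trans _ (@refactor_step R) (rot a0.-1 (factor_list L U)) Ft /\
  type_word Ft = sigma_min p q.

Definition cyclic_mx (A : comNzRingType) (s : seq (bidiag A)) (a : nat) :
  smatrix A := bidiag_prod (rot a.-1 s).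

Definition cyclic_dist (M a b : nat) : nat := ((b + M - a) %% M)%N.

Definition partial_mx (A : comNzRingType) (s : seq (bidiag A)) (a b : nat) :
  smatrix A := bidiag_prod (take (cyclic_dist (size s) a b) (rot a.-1 s)).

Definition moment (A : comNzRingType) (s : seq (bidiag A)) (a b k : nat) : A :=
  smulmx (partial_mx s a b) (smxexp (cyclic_mx s b) k) 0%N 0%N.

Definition hankel_minor (A : comNzRingType) (m : nat -> A) (k : nat)
    (r c : 'I_k -> nat) : A :=
  \det (\matrix_(i < k, j < k) m (r i + c j)%N).

(* The polynomial Q in the coefficients of the list s, the i-th variable being
   replaced by the n-th coefficient of the j-th factor (0-based), (j, n) = v i. *)
Definition eval_coefs (A : comNzRingType) (M N : nat) (v : 'I_N -> 'I_M * nat)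
    (Q : mpoly.mpoly N int) (s : seq (bidiag A)) : A :=
  mpoly.mmap (intr : int -> A) (fun i => coef s (v i).1 (v i).2) Q.

Definition nonneg_coefs (N : nat) (Q : mpoly.mpoly N int) : Prop :=
  forall m, 0 <= mpoly.mcoeff m Q.

Definition measure_support (R : realType)
    (rho : {measure set (measurableTypeR R) -> \bar R}) : set R :=
  [set x : R | forall V : set R, open V -> V x -> (0 < rho V)%E].

(* Measures on [0, +oo[ are the Borel measures on R carried by [0, +oo[. *)
Definition represents (R : realType)
    (rho : {measure set (measurableTypeR R) -> \bar R}) (m : nat -> R) : Prop :=
  rho `]-oo, 0%R[%classic = 0%E /\
  forall k, (\int[rho]_(x in `[0%R, +oo[%classic) (x ^+ k)%:E = (m k)%:E)%E.

Definition bounded_coefs (R : realType) (s : seq (bidiag R)) : Prop :=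
  exists C : R, forall i n, (i < size s)%N -> `|coef s i n| <= C.

(* Main.v *)
Require Import Defs.
From HB Require Import structures.
From mathcomp Require Import all_boot all_order all_algebra.
From mathcomp Require Import all_classical all_reals all_analysis.
From mathcomp Require mpoly.
From mathcomp Require Import measurable_realfun zify ring lra.

Set Implicit Arguments.
Unset Strict Implicit.
Unset Printing Implicit Defensive.

Import Order.TTheory GRing.Theory Num.Theory numFieldNormedType.Exports.

Local Open Scope classical_set_scope.
Local Open Scope ring_scope.

(** A moment is an entry at height 0 of a product of bidiagonal factors, that
    is, a weighted sum over lattice paths which at a lower factor stay or go
    down by one and at an upper factor stay or go up by one. Two such paths
    cannot exchange their order without meeting. Starting points at height 0 at
    the times of the powers [r i] and end points at height 0 at the times of the
    powers [c j] make the Hankel minors sums over families of disjoint paths, as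
    in the lemma of Lindstrom, Gessel and Viennot. This is carried out by
    multilinearity of the determinant alone: a bidiagonal factor replaces each
    row by a combination of two neighbours, and the choices that do not keep the
    rows distinct contribute nothing ([interlacing_minor], [minors_in_step]).
    Since no subtraction occurs, the argument works over any subsemiring
    ([hankel_minor_in]); applied to generic coefficients it gives polynomials
    with nonnegative integer coefficients ([hankel_minor_polynomial]).

    For positive coefficients one family of disjoint paths suffices for strict
    positivity. In each period all the paths that have already started rise by
    one at an upper factor, which leaves height 0 to the next one, and later they
    come down in the same way at a lower factor ([hankel_det_gt0]).

    The rest is the Stieltjes moment problem. Positive determinants make the
    functional [L] with [L ('X^k) = m_k] positive on squares and on ['X] times
    squares, hence on the polynomials that are nonnegative on the half line
    ([halfline_functional_ge0]). Riesz' extension theorem assigns values [S t] to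
    the indicators of the rays beyond [t] ([tail_values]), a measure with the
    tails [S] exists ([measure_of_tails]), and comparing powers with step
    functions shows that its moments are the given ones ([tails_moments]). Its
    support is infinite because [L] is strictly positive on nonzero squares.

    Bounded coefficients bound the moments geometrically, so a representing
    measure gives no mass to a remote ray ([represents_bounded]). On the
    remaining interval the polynomials [(1 - y ^ n) ^ N] with suitable exponents
    converge boundedly to the indicator of an initial segment, so that the
    moments determine the measure of all rays ([represents_unique]). *)

(** * Bidiagonal products acting on columns *)

(** The product of a bidiagonal matrix with a column: at most two terms of the
    infinite sum defining it are nonzero. *)
Definition bact (A : comNzRingType) (F : bidiag A) (x : nat -> A) : nat -> A :=
  match F with
  | Lower l => fun i => if i is i'.+1 then x i + l i' * x i' else x i
  | Upper u => fun i => u i * x i + x i.+1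
  end.

Definition wact (A : comNzRingType) (s : seq (bidiag A)) (x : nat -> A) :=
  foldr (@bact A) x s.

Definition e0 (A : comNzRingType) : nat -> A := fun i => (i == 0%N)%:R.

Lemma smulmx_finite_row (A : comNzRingType) (M N : smatrix A) i j n :
  (forall k, (n <= k)%N -> M i k = 0) ->
  smulmx M N i j = \sum_(k < n) M i k * N k j.
Proof.
move=> M0; rewrite (fsbig_ord _ n (fun k => M i k * N k j)).
apply/esym; apply: fsbig_widen => // k [_ /= nk].
by rewrite /= M0 ?mul0r// leqNgt; apply/negP.
Qed.

Lemma mx_of_bidiag_row (A : comNzRingType) (F : bidiag A) i k :
  (i.+2 <= k)%N -> mx_of_bidiag F i k = 0.
Proof.
case: F => [l|u] ik /=.
  have -> : (i == k) = false by apply/negbTE; lia.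
  have -> : (i == k.+1) = false by apply/negbTE; lia.
  by rewrite addr0.
have -> : (i == k) = false by apply/negbTE; lia.
have -> : (k == i.+1) = false by apply/negbTE; lia.
by rewrite addr0.
Qed.

Lemma smulmx_bidiag (A : comNzRingType) (F : bidiag A) (N : smatrix A) i j :
  smulmx (mx_of_bidiag F) N i j = bact F (N^~ j) i.
Proof.
rewrite (@smulmx_finite_row _ _ _ _ _ i.+2); last exact: mx_of_bidiag_row.
case: F => [l|u] /=.
  case: i => [|i].
    rewrite !big_ord_recl big_ord0 /= mulr0n !addr0 mul1r.
    by rewrite mul0r addr0.
  rewrite !big_ord_recr /= big1 ?add0r; last first.
    move=> k _; have -> : (i.+1 == k) = false by apply/negbTE; have := ltn_ord k; lia.
    have -> : (i.+1 == k.+1) = false by apply/negbTE; have := ltn_ord k; lia.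
    by rewrite addr0 mul0r.
  rewrite !eqxx /= mulr1n.
  have -> : (i.+1 == i) = false by apply/negbTE; lia.
  have -> : (i.+1 == i.+2) = false by apply/negbTE; lia.
  have -> : (i.+1 == i.+3) = false by apply/negbTE; lia.
  by rewrite add0r mulr0n !addr0 mul1r mul0r addr0 addrC.
rewrite !big_ord_recr /= big1 ?add0r; last first.
  move=> k _; have -> : (i == k) = false by apply/negbTE; have := ltn_ord k; lia.
  have -> : (nat_of_ord k == i.+1) = false by apply/negbTE; have := ltn_ord k; lia.
  by rewrite mulr0n add0r mul0r.
rewrite !eqxx /=.
have -> : (i == i.+1) = false by apply/negbTE; lia.
by rewrite mulr0n mulr1n add0r addr0 mul1r.
Qed.

Lemma bidiag_prod_row (A : comNzRingType) (s : seq (bidiag A)) i k :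
  (i + size s < k)%N -> bidiag_prod s i k = 0.
Proof.
elim: s i => [|F s IH] i /=.
  by rewrite addn0 /smx1 => ik; rewrite (_ : (i == k) = false)//; apply/negbTE; lia.
rewrite smulmx_bidiag => ik.
case: F => [l|u] /=; last by rewrite !IH ?mulr0 ?addr0//; lia.
by case: i ik => [|i] ik; rewrite !IH ?mulr0 ?addr0//; lia.
Qed.

Lemma smulmx_bidiag_prod (A : comNzRingType) (s : seq (bidiag A))
    (N : smatrix A) i j :
  smulmx (bidiag_prod s) N i j = wact s (N^~ j) i.
Proof.
elim: s i => [|F s IH] i.
  rewrite (@smulmx_finite_row _ _ _ _ _ i.+1) => [|k ik].
    rewrite big_ord_recr big1 /= /smx1 ?eqxx ?mul1r ?add0r// => k _.
    by rewrite (_ : (i == k) = false) ?mul0r//; apply/negbTE; have := ltn_ord k; lia.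
  by rewrite /= /smx1 (_ : (i == k) = false)//; apply/negbTE; lia.
have [n hn] : exists n, n = (i + size s).+2 by exists (i + size s).+2.
have E i' : (i' <= i.+1)%N ->
    wact s (N^~ j) i' = \sum_(k < n) bidiag_prod s i' k * N k j.
  move=> h; rewrite -IH; apply: smulmx_finite_row => k nk.
  by rewrite bidiag_prod_row//; lia.
rewrite (@smulmx_finite_row _ _ _ _ _ n) => [|k ik]; last first.
  by rewrite bidiag_prod_row//=; lia.
under eq_bigr do rewrite [bidiag_prod _]/= smulmx_bidiag.
case: F => [l|u] /=; last first.
  rewrite !E// mulr_sumr -big_split /=; apply: eq_bigr => k _; ring.
case: i E {hn} => [|i] E; first by rewrite !E.
rewrite !E; [|by lia..].
by rewrite mulr_sumr -big_split /=; apply: eq_bigr => k _; ring.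
Qed.

Lemma moment_wact (A : comNzRingType) (s : seq (bidiag A)) a b k :
  moment s a b k = wact (take (cyclic_dist (size s) a b) (rot a.-1 s))
    (iter k (wact (rot b.-1 s)) (@e0 A)) 0%N.
Proof.
rewrite /moment smulmx_bidiag_prod; congr (wact _ _ _).
elim: k => [//|k IH]; apply/funext => i.
by rewrite /smxexp iterS smulmx_bidiag_prod -/(smxexp _ k) IH.
Qed.

Lemma wact_cat (A : comNzRingType) (s t : seq (bidiag A)) x :
  wact (s ++ t) x = wact s (wact t x).
Proof. exact: foldr_cat. Qed.

Lemma rot_cyclic_dist (T : Type) (s : seq T) a b :
  (1 <= a <= size s)%N -> (1 <= b <= size s)%N ->
  rot b.-1 s = rot (cyclic_dist (size s) a b) (rot a.-1 s).
Proof.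
move=> /andP[a1 aM] /andP[b1 bM].
have aS : (a.-1 <= size s)%N by lia.
have s0 : (0 < size s)%N by lia.
rewrite rot_add_mod ?size_rot//; last by rewrite ltnW// ltn_mod.
rewrite /cyclic_dist.
have [ab|ba] := leqP a b.
  have -> : (b + size s - a = (b - a) + size s)%N by lia.
  rewrite modnDr modn_small; last lia.
  have -> : (b - a + a.-1 = b.-1)%N by lia.
  by rewrite ifT//; lia.
rewrite modn_small; last lia.
have [|h] := leqP (b + size s - a + a.-1) (size s).
  move=> h; have -> : b = 1%N by lia.
  have -> : (1 + size s - a + a.-1 = size s)%N by lia.
  by rewrite rot_size rot0.
by congr rot; lia.
Qed.

(** With [F] the factors from [a] to [b] and [G] the remaining ones, the cyclic
    products are [F G] and [G F], hence [(F G) ^ r F = F (G F) ^ r]. A Hankel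
    entry becomes the pairing of a row depending on [r] with a column depending
    on [c]. *)
Lemma moment_split (A : comNzRingType) (s : seq (bidiag A)) a b r c :
  (1 <= a <= size s)%N -> (1 <= b <= size s)%N ->
  moment s a b (r + c)%N = iter r (wact (rot a.-1 s))
    (wact (take (cyclic_dist (size s) a b) (rot a.-1 s))
      (iter c (wact (rot b.-1 s)) (@e0 A))) 0%N.
Proof.
move=> ha hb; rewrite moment_wact (rot_cyclic_dist ha hb).
set d := cyclic_dist _ _ _; set t := rot a.-1 s.
rewrite iterD; move: (iter c _ _) => x.
congr (_ 0%N); elim: r x => [//|r IH] x.
rewrite iterSr IH iterSr; congr iter.
by rewrite /rot wact_cat -wact_cat cat_take_drop.
Qed.

(** * Total positivity of the Hankel matrices *)

(** Minors will be obtained without any subtraction. An abstract subsemiring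
    covers both nonnegative numbers and polynomials with nonnegative
    coefficients. *)
Definition subsemiring (A : comNzRingType) (C : A -> Prop) : Prop :=
  [/\ C 0, C 1, forall x y, C x -> C y -> C (x + y) &
      forall x y, C x -> C y -> C (x * y)].

Lemma subsemiring_sum (A : comNzRingType) (C : A -> Prop) (I : Type) (s : seq I)
    (P : pred I) (f : I -> A) :
  subsemiring C -> (forall i, C (f i)) -> C (\sum_(i <- s | P i) f i).
Proof. by case=> C0 _ CD _ Cf; elim/big_ind: _. Qed.

Lemma subsemiring_prod (A : comNzRingType) (C : A -> Prop) (I : Type) (s : seq I)
    (P : pred I) (f : I -> A) :
  subsemiring C -> (forall i, C (f i)) -> C (\prod_(i <- s | P i) f i).
Proof. by case=> _ C1 _ CM Cf; elim/big_ind: _. Qed.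

(** Only rows are selected: columns are introduced one by one, and every minor
    considered uses all the columns present. *)
Definition rowminor (A : comNzRingType) k (Z : nat -> nat -> A)
    (r : 'I_k -> nat) : A :=
  \det (\matrix_(i < k, j < k) Z (r i) j).

Definition minors_in (A : comNzRingType) (C : A -> Prop) k
    (Z : nat -> nat -> A) : Prop :=
  forall r : 'I_k -> nat, {homo r : i j / (i < j)%N} -> C (rowminor Z r).

Lemma eq_rowminor (A : comNzRingType) k (Z Z' : nat -> nat -> A)
    (r r' : 'I_k -> nat) :
  (forall i j : 'I_k, Z (r i) j = Z' (r' i) j) -> rowminor Z r = rowminor Z' r'.
Proof. by move=> h; congr (\det _); apply/matrixP => i j; rewrite !mxE. Qed.

Lemma eq_minors_in (A : comNzRingType) (C : A -> Prop) k (Z Z' : nat -> nat -> A) :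
  (forall i j, (j < k)%N -> Z i j = Z' i j) -> minors_in C k Z -> minors_in C k Z'.
Proof.
move=> h hZ r hr; rewrite -(@eq_rowminor _ _ Z Z' r)//; first exact: hZ.
by move=> i j; rewrite h.
Qed.

Lemma det_row_choices (A : comNzRingType) k (a : 'I_k -> bool -> A)
    (X : 'I_k -> bool -> 'I_k -> A) :
  \det (\matrix_(i, j) \sum_(b : bool) a i b * X i b j) =
  \sum_(f : {ffun 'I_k -> bool})
     (\prod_i a i (f i)) * \det (\matrix_(i, j) X i (f i) j).
Proof.
rewrite /determinant.
under eq_bigr => s _.
  under eq_bigr do rewrite mxE.
  rewrite bigA_distr_bigA big_distrr /=.
  under eq_bigr do rewrite big_split /= mulrCA.
  over.
rewrite exchange_big /=; apply: eq_bigr => f _.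
by rewrite big_distrr /=; apply: eq_bigr => s _; do 2!congr (_ * _);
  apply: eq_bigr => i _; rewrite mxE.
Qed.

Definition row_step (A : comNzRingType) (al : nat -> bool -> A)
    (h : nat -> bool -> nat) (Z : nat -> nat -> A) : nat -> nat -> A :=
  fun i c => \sum_(b : bool) al i b * Z (h i b) c.

Definition interlacing (h : nat -> bool -> nat) : Prop :=
  forall i j b b', (i < j)%N -> (h i b <= h j b')%N.

Lemma rowminor_step (A : comNzRingType) k al h (Z : nat -> nat -> A)
    (r : 'I_k -> nat) :
  rowminor (row_step al h Z) r = \sum_(f : {ffun 'I_k -> bool})
     (\prod_i al (r i) (f i)) * rowminor Z (fun i => h (r i) (f i)).
Proof. exact: det_row_choices. Qed.

(** The chosen rows increase weakly. If two of them coincide the determinant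
    vanishes, which is the cancellation of intersecting paths in the lemma of
    Lindstrom, Gessel and Viennot. *)
Lemma interlacing_minor (A : comNzRingType) (C : A -> Prop) k h
    (Z : nat -> nat -> A) (r : 'I_k -> nat) (f : 'I_k -> bool) :
  C 0 -> interlacing h -> minors_in C k Z -> {homo r : i j / (i < j)%N} ->
  C (rowminor Z (fun i => h (r i) (f i))).
Proof.
move=> C0 hh hZ hr; set r' := fun i => _.
have [hs|/existsNP[i /existsNP[j /not_implyP[ij hij]]]] :=
  pselect (forall i j : 'I_k, (i < j)%N -> (r' i < r' j)%N); first exact: hZ.
rewrite /rowminor (@determinant_alternate _ _ _ i j)//.
  by apply/eqP => e; rewrite e ltnn in ij.
move=> c; rewrite !mxE; congr Z; apply/eqP.
by rewrite eqn_leq hh ?hr//= leqNgt; apply/negP.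
Qed.

(** This takes the place of the Cauchy-Binet formula for factors with at most
    two nonzero entries in each row. *)
Lemma minors_in_step (A : comNzRingType) (C : A -> Prop) k al h
    (Z : nat -> nat -> A) :
  subsemiring C -> (forall i b, C (al i b)) -> interlacing h ->
  minors_in C k Z -> minors_in C k (row_step al h Z).
Proof.
move=> hC Ca hh hZ r hr; rewrite rowminor_step.
have [C0 _ _ CM] := hC.
apply: subsemiring_sum => // f; apply: CM; first exact: subsemiring_prod.
exact: (@interlacing_minor _ _ _ _ _ _ (fun i => f i) C0 hh hZ hr).
Qed.

Definition nonneg (R : numDomainType) : R -> Prop := fun x => 0 <= x.

Lemma subsemiring_nonneg (R : numDomainType) : subsemiring (@nonneg R).
Proof. by split; rewrite /nonneg ?ler01// => x y; [exact: addr_ge0|exact: mulr_ge0]. Qed.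

Lemma rowminor_step_gt0 (R : realDomainType) k al h (Z : nat -> nat -> R)
    (r : 'I_k -> nat) (f : 'I_k -> bool) :
  (forall i b, 0 <= al i b) -> interlacing h -> minors_in (@nonneg R) k Z ->
  {homo r : i j / (i < j)%N} -> (forall i, 0 < al (r i) (f i)) ->
  0 < rowminor Z (fun i => h (r i) (f i)) -> 0 < rowminor (row_step al h Z) r.
Proof.
move=> al0 hh hZ hr alf hf; rewrite rowminor_step (bigD1 [ffun i => f i])//=.
apply: ltr_wpDr.
  apply: sumr_ge0 => g _; rewrite mulr_ge0 ?prodr_ge0//.
  exact: (@interlacing_minor _ (@nonneg R) _ _ _ _ (fun i => g i) (lexx 0) hh hZ hr).
rewrite mulr_gt0//; first by rewrite prodr_gt0// => i _; rewrite ffunE.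
by rewrite (@eq_rowminor _ _ _ Z _ (fun i => h (r i) (f i)))// => i j; rewrite ffunE.
Qed.

(** The rows below [d] are frozen, so that different rows can end up with
    different powers of the same operator. *)
Definition act_from (A : Type) d (g : (nat -> A) -> nat -> A)
    (Z : nat -> nat -> A) : nat -> nat -> A :=
  fun i c => if (i < d)%N then Z i c else g (fun h => Z (d + h)%N c) (i - d)%N.

Lemma act_from_comp (A : Type) d (g g' : (nat -> A) -> nat -> A) Z :
  act_from d (g \o g') Z = act_from d g (act_from d g' Z).
Proof.
apply/funext => i; apply/funext => c; rewrite /act_from /=.
case: ltnP => // _; congr g; apply/funext => h.
by rewrite ltnNge leq_addr /= addKn.
Qed.

Lemma act_from_id (A : Type) d (Z : nat -> nat -> A) : act_from d id Z = Z.
Proof.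
apply/funext => i; apply/funext => c; rewrite /act_from /=.
by case: ltnP => // ?; rewrite subnKC.
Qed.

(** The two rows that are combined into row [i] of the product, with their
    weights in [bidiag_weight]. A row with a single contribution lists itself
    twice, the second time with weight [0]. *)
Definition bidiag_row d (A : Type) (F : bidiag A) (i : nat) (b : bool) : nat :=
  match F with
  | Lower _ => if b then i else if (i <= d)%N then i else i.-1
  | Upper _ => if b then i else if (i < d)%N then i else i.+1
  end.

Definition bidiag_weight d (A : comNzRingType) (F : bidiag A) (i : nat)
    (b : bool) : A :=
  match F with
  | Lower l => if b then 1 else if (i <= d)%N then 0 else l (i - d.+1)%N
  | Upper u => if b then (if (i < d)%N then 1 else u (i - d)%N)
               else (if (i < d)%N then 0 else 1)
  end.

Lemma act_from_bact d (A : comNzRingType) (F : bidiag A) Z :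
  act_from d (bact F) Z = row_step (bidiag_weight d F) (bidiag_row d F) Z.
Proof.
apply/funext => i; apply/funext => c; rewrite /act_from /row_step big_bool /=.
case: F => [l|u] /=; case: ltngtP => // id; rewrite ?mul1r ?mul0r ?addr0//.
- case E : (i - d)%N => [|n]; first by lia.
  have -> : (d + n.+1 = i)%N by lia.
  have -> : (d + n = i.-1)%N by lia.
  by have -> : (i - d.+1 = n)%N by lia.
- by rewrite id subnn addn0.
- by rewrite addnS subnKC// ltnW.
- by rewrite id subnn addn0 addn1.
Qed.

Lemma bidiag_row_interlacing d (A : Type) (F : bidiag A) :
  interlacing (bidiag_row d F).
Proof.
by move=> i j [] [] ij; case: F => x /=; do ?case: ifP; lia.
Qed.

Definition coeffs_in (A : comNzRingType) (C : A -> Prop) (s : seq (bidiag A)) :=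
  forall i n, (i < size s)%N -> C (coef s i n).

Lemma coeffs_in_cons (A : comNzRingType) (C : A -> Prop) F (s : seq (bidiag A)) :
  coeffs_in C (F :: s) <-> (forall n, C (coeffs F n)) /\ coeffs_in C s.
Proof.
split=> [h|[h1 h2]]; last by case=> [|i] n; [move=> _; exact: h1|exact: h2].
by split => [n|i n]; [exact: (h 0%N n)|exact: (h i.+1 n)].
Qed.

Lemma coeffs_in_cat (A : comNzRingType) (C : A -> Prop) (s t : seq (bidiag A)) :
  coeffs_in C (s ++ t) <-> coeffs_in C s /\ coeffs_in C t.
Proof.
elim: s => [|F s IH]; first by split=> [h|[]].
rewrite cat_cons !coeffs_in_cons IH; tauto.
Qed.

Lemma coeffs_in_rot (A : comNzRingType) (C : A -> Prop) n (s : seq (bidiag A)) :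
  coeffs_in C s -> coeffs_in C (rot n s).
Proof.
by rewrite -{1}(cat_take_drop n s) !coeffs_in_cat => -[].
Qed.

Lemma coeffs_in_take (A : comNzRingType) (C : A -> Prop) n (s : seq (bidiag A)) :
  coeffs_in C s -> coeffs_in C (take n s).
Proof. by rewrite -{1}(cat_take_drop n s) coeffs_in_cat => -[]. Qed.

Lemma minors_in_bact (A : comNzRingType) (C : A -> Prop) k d (F : bidiag A) Z :
  subsemiring C -> (forall n, C (coeffs F n)) ->
  minors_in C k Z -> minors_in C k (act_from d (bact F) Z).
Proof.
move=> hC CF hZ; rewrite act_from_bact; apply: minors_in_step => //.
  have [C0 C1 _ _] := hC.
  by move=> i []; case: F CF => x /= Cx; do ?case: ifP.
exact: bidiag_row_interlacing.
Qed.

Lemma minors_in_wact (A : comNzRingType) (C : A -> Prop) k d s (Z : nat -> nat -> A) :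
  subsemiring C -> coeffs_in C s ->
  minors_in C k Z -> minors_in C k (act_from d (wact s) Z).
Proof.
move=> hC + hZ; elim: s => [_|F s IH].
  by rewrite (_ : wact [::] = id)// act_from_id.
rewrite coeffs_in_cons => -[CF Cs].
rewrite (_ : wact (F :: s) = bact F \o wact s)// act_from_comp.
by apply: minors_in_bact => //; exact: IH.
Qed.

Lemma minors_in_iter (A : comNzRingType) (C : A -> Prop) k d s n
    (Z : nat -> nat -> A) :
  subsemiring C -> coeffs_in C s ->
  minors_in C k Z -> minors_in C k (act_from d (iter n (wact s)) Z).
Proof.
move=> hC Cs hZ; elim: n => [|n IH].
  by rewrite (_ : iter 0 (wact s) = id)// act_from_id.
rewrite (_ : iter n.+1 (wact s) = wact s \o iter n (wact s))// act_from_comp.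
exact: minors_in_wact.
Qed.

(** In terms of paths, the new column is the end point at height [0] and at the
    current time. *)
Definition add_col (A : comNzRingType) (Z : nat -> nat -> A) : nat -> nat -> A :=
  fun i c => if c is c'.+1 then Z i c' else @e0 A i.

Lemma rowminor_add_col (A : comNzRingType) k (Z : nat -> nat -> A)
    (r : 'I_k.+1 -> nat) :
  {homo r : i j / (i < j)%N} ->
  rowminor (add_col Z) r =
  if r ord0 == 0%N then rowminor Z (r \o lift ord0) else 0.
Proof.
move=> hr; rewrite /rowminor (expand_det_col _ ord0) big_ord_recl big1 ?addr0.
  rewrite !mxE /= /e0; case: eqP => _; last by rewrite mul0r.
  rewrite mul1r /cofactor addn0 expr0 mul1r; congr (\det _).
  by apply/matrixP => i j; rewrite !mxE.
move=> i _; rewrite !mxE /= /e0.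
have : (r ord0 < r (lift ord0 i))%N by apply: hr.
by move=> h; rewrite gtn_eqF ?mul0r//; exact: leq_ltn_trans h.
Qed.

Lemma minors_in_add_col (A : comNzRingType) (C : A -> Prop) k (Z : nat -> nat -> A) :
  C 0 -> minors_in C k Z -> minors_in C k.+1 (add_col Z).
Proof.
move=> C0 hZ r hr; rewrite rowminor_add_col//; case: ifP => // _.
by apply: hZ => i j ij; apply: hr; rewrite !lift0.
Qed.

Lemma minors_in0 (A : comNzRingType) (C : A -> Prop) (Z : nat -> nat -> A) :
  C 1 -> minors_in C 0 Z.
Proof. by move=> C1 r _; rewrite /rowminor det_mx00. Qed.

Definition power_cols (A : comNzRingType) (s : seq (bidiag A)) (c : nat -> nat) :
  nat -> nat -> A := fun i j => iter (c j) (wact s) (@e0 A) i.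

(** Horner's rule: the smallest power is common to all the columns, and the
    first one is [e0] once it is taken out. *)
Lemma power_cols_recl (A : comNzRingType) (s : seq (bidiag A)) (c : nat -> nat) :
  (forall j, (c 0 <= c j)%N) ->
  act_from 0 (iter (c 0%N) (wact s))
    (add_col (power_cols s (fun j => (c j.+1 - c 0)%N))) = power_cols s c.
Proof.
move=> hc; apply/funext => i; apply/funext => -[|j]; rewrite /act_from /= subn0//.
by rewrite /power_cols -[in RHS](subnKC (hc j.+1)) iterD.
Qed.

Lemma minors_in_power_cols (A : comNzRingType) (C : A -> Prop) k
    (s : seq (bidiag A)) (c : nat -> nat) :
  subsemiring C -> coeffs_in C s ->
  (forall i j, (i < j < k)%N -> (c i < c j)%N) ->
  minors_in C k (power_cols s c).
Proof.
move=> hC Cs; have [C0 C1 _ _] := hC.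
elim: k c => [|k IH] c hc; first exact: minors_in0.
pose c' j := if (j <= k)%N then c j else (c 0%N + j)%N.
apply: (@eq_minors_in _ _ _ (power_cols s c')).
  by move=> i j; rewrite ltnS /power_cols /c' => ->.
rewrite -power_cols_recl; last first.
  case=> [//|j]; rewrite /c' leq0n; case: ifP => jk; last exact: leq_addr.
  by rewrite ltnW// hc.
apply: minors_in_iter => //; apply: minors_in_add_col => //; apply: IH => i j ijk.
have h0 : (c 0 < c i.+1)%N by apply: hc; lia.
have h1 : (c i.+1 < c j.+1)%N by apply: hc; lia.
by rewrite /c' leq0n !ifT; lia.
Qed.

(** Row [d] is about to be frozen, and a copy of it is left to evolve as row
    [d.+1]. In terms of paths, [d] is a new starting point at height [0]. *)
Definition duplicate_row (A : Type) d (Z : nat -> nat -> A) : nat -> nat -> A :=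
  fun i => Z (if (i <= d)%N then i else i.-1).

Lemma minors_in_duplicate_row (A : comNzRingType) (C : A -> Prop) k d
    (Z : nat -> nat -> A) :
  subsemiring C -> minors_in C k Z -> minors_in C k (duplicate_row d Z).
Proof.
move=> hC hZ; have [C0 C1 _ _] := hC.
have -> : duplicate_row d Z = row_step (fun _ b => b%:R)
    (fun i _ => if (i <= d)%N then i else i.-1) Z.
  apply/funext => i; apply/funext => c.
  by rewrite /row_step big_bool /= mul1r mul0r addr0.
apply: minors_in_step => //; first by move=> _ [].
by move=> i j _ _ ij; do 2!case: ifP; lia.
Qed.

(** The rows [i <= d] hold the entries at height [0] for the powers [r i]; the
    row [d + h] holds height [h] for the power [r d]. Row [d] has both
    readings. *)
Definition recorded (A : comNzRingType) (s : seq (bidiag A)) (r : nat -> nat)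
    (Y : nat -> nat -> A) d : nat -> nat -> A :=
  fun i c => iter (r (minn i d)) (wact s) (Y^~ c) (i - d)%N.

Lemma recordedS (A : comNzRingType) (s : seq (bidiag A)) r Y d :
  (r d <= r d.+1)%N ->
  recorded s r Y d.+1 =
  act_from d.+1 (iter (r d.+1 - r d) (wact s)) (duplicate_row d (recorded s r Y d)).
Proof.
move=> hr; apply/funext => i; apply/funext => c.
rewrite /recorded /act_from /duplicate_row ltnS; case: (leqP i d) => idd.
  rewrite (minn_idPl idd) (minn_idPl (leqW idd)).
  have -> : (i - d = 0)%N by apply/eqP.
  by have -> : (i - d.+1 = 0)%N by apply/eqP/leqW.
rewrite (minn_idPr idd) -{1}(subnK hr) iterD; congr (iter _ _ _ _).
apply/funext => h; rewrite ifF; last lia.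
by rewrite addSn /= (minn_idPr (leq_addr _ _)) addKn.
Qed.

Lemma minors_in_recorded (A : comNzRingType) (C : A -> Prop) k
    (s : seq (bidiag A)) (r : nat -> nat) (Y : nat -> nat -> A) d :
  subsemiring C -> coeffs_in C s ->
  (forall i j, (i < j < k)%N -> (r i < r j)%N) -> (d < k)%N ->
  minors_in C k Y -> minors_in C k (recorded s r Y d).
Proof.
move=> hC Cs hr + hY; elim: d => [|d IH] dk.
  have -> : recorded s r Y 0 = act_from 0 (iter (r 0%N) (wact s)) Y.
    by apply/funext => i; apply/funext => c; rewrite /recorded /act_from minn0.
  exact: minors_in_iter.
rewrite recordedS; last by rewrite ltnW// hr// ltnSn.
by apply: minors_in_iter => //; apply: minors_in_duplicate_row => //; apply: IH; lia.
Qed.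

Definition hankel_start (A : comNzRingType) (s : seq (bidiag A)) a b c :=
  act_from 0 (wact (take (cyclic_dist (size s) a b) (rot a.-1 s)))
    (power_cols (rot b.-1 s) c).

Lemma recorded_hankel (A : comNzRingType) (s : seq (bidiag A)) a b k r c :
  (1 <= a <= size s)%N -> (1 <= b <= size s)%N ->
  rowminor (recorded (rot a.-1 s) r (hankel_start s a b c) k)
    (fun i : 'I_k.+1 => nat_of_ord i) =
  \det (\matrix_(i < k.+1, j < k.+1) moment s a b (r i + c j)%N).
Proof.
move=> ha hb; congr (\det _); apply/matrixP => i j; rewrite !mxE moment_split//.
have ik : (i <= k)%N by rewrite -ltnS ltn_ord.
rewrite /recorded (minn_idPl ik) (_ : (i - k = 0)%N); last by apply/eqP.
congr (iter _ _ _ _); apply/funext => h.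
by rewrite /hankel_start /act_from subn0.
Qed.

(** By [moment_split] the entries are those at height [0] of the columns
    [F T_b ^ (c j) e0] after multiplication by [T_a ^ (r i)]. The columns are
    produced by [add_col] and the rows by [duplicate_row], and both keep the
    minors in [C]. *)
Lemma hankel_minor_in (A : comNzRingType) (C : A -> Prop) (s : seq (bidiag A))
    a b k (r c : nat -> nat) :
  subsemiring C -> coeffs_in C s ->
  (1 <= a <= size s)%N -> (1 <= b <= size s)%N ->
  (forall i j, (i < j < k)%N -> (r i < r j)%N) ->
  (forall i j, (i < j < k)%N -> (c i < c j)%N) ->
  C (\det (\matrix_(i < k, j < k) moment s a b (r i + c j)%N)).
Proof.
move=> hC Cs ha hb hr hc; have [_ C1 _ _] := hC.
case: k hr hc => [|k] hr hc; first by rewrite det_mx00.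
rewrite -recorded_hankel//; apply: minors_in_recorded => //.
  exact: coeffs_in_rot.
apply: minors_in_wact => //; first by apply: coeffs_in_take; exact: coeffs_in_rot.
by apply: minors_in_power_cols => //; exact: coeffs_in_rot.
Qed.

(** * Strict positivity of the leading determinants *)

Definition positive (R : numDomainType) : R -> Prop := fun x => 0 < x.

Lemma coeffs_in_nonneg (R : numDomainType) (s : seq (bidiag R)) :
  coeffs_in (@positive R) s -> coeffs_in (@nonneg R) s.
Proof. by move=> h i n im; apply/ltW/h. Qed.

Lemma rowminor_bact_gt0 (R : realDomainType) k d (F : bidiag R)
    (Z : nat -> nat -> R) (r : 'I_k -> nat) (f : 'I_k -> bool) :
  (forall n, 0 < coeffs F n) -> minors_in (@nonneg R) k Z ->
  {homo r : i j / (i < j)%N} -> (forall i, 0 < bidiag_weight d F (r i) (f i)) ->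
  0 < rowminor Z (fun i => bidiag_row d F (r i) (f i)) ->
  0 < rowminor (act_from d (bact F) Z) r.
Proof.
move=> F0 hZ hr hf; rewrite act_from_bact; apply: rowminor_step_gt0 => //.
  by move=> i []; case: F F0 {hf} => x x0 /=; do ?case: ifP; rewrite // ltW.
exact: bidiag_row_interlacing.
Qed.

Lemma rowminor_stay_gt0 (R : realDomainType) k d (s : seq (bidiag R))
    (Z : nat -> nat -> R) (r : 'I_k -> nat) :
  coeffs_in (@positive R) s -> minors_in (@nonneg R) k Z ->
  {homo r : i j / (i < j)%N} -> 0 < rowminor Z r ->
  0 < rowminor (act_from d (wact s) Z) r.
Proof.
move=> + hZ hr Z0; elim: s => [_|F s IH].
  by rewrite (_ : wact [::] = id)// act_from_id.
rewrite coeffs_in_cons => -[F0 Cs].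
rewrite (_ : wact (F :: s) = bact F \o wact s)// act_from_comp.
apply: (rowminor_bact_gt0 (f := fun=> true)) => //.
- apply: minors_in_wact => //; first exact: subsemiring_nonneg.
  exact: coeffs_in_nonneg.
- by move=> i; case: F F0 => x x0 //=; case: ifP => _ //; exact: x0.
- rewrite (@eq_rowminor _ _ _ (act_from d (wact s) Z) _ r); first exact: IH.
  by move=> i j; case: F {F0}.
Qed.

Lemma rowminor_stay_iter_gt0 (R : realDomainType) k d (s : seq (bidiag R)) n
    (Z : nat -> nat -> R) (r : 'I_k -> nat) :
  coeffs_in (@positive R) s -> minors_in (@nonneg R) k Z ->
  {homo r : i j / (i < j)%N} -> 0 < rowminor Z r ->
  0 < rowminor (act_from d (iter n (wact s)) Z) r.
Proof.
move=> Cs hZ hr Z0; elim: n => [|n IH].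
  by rewrite (_ : iter 0 (wact s) = id)// act_from_id.
rewrite (_ : iter n.+1 (wact s) = wact s \o iter n (wact s))// act_from_comp.
apply: rowminor_stay_gt0 => //; apply: minors_in_iter => //.
  exact: subsemiring_nonneg.
exact: coeffs_in_nonneg.
Qed.

(** One factor of the word moves all the paths at once, and the other ones leave
    them in place. *)
Lemma rowminor_move_gt0 (R : realDomainType) k d (s : seq (bidiag R)) F
    (Z : nat -> nat -> R) (r r' : 'I_k -> nat) (f : 'I_k -> bool) :
  coeffs_in (@positive R) s -> minors_in (@nonneg R) k Z ->
  F \in [set G | exists s1 s2, s = s1 ++ G :: s2] ->
  {homo r : i j / (i < j)%N} -> {homo r' : i j / (i < j)%N} ->
  (forall i, bidiag_row d F (r i) (f i) = r' i) ->
  ((forall n, 0 < coeffs F n) ->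
    forall i, 0 < bidiag_weight d F (r i) (f i)) ->
  0 < rowminor Z r' ->
  0 < rowminor (act_from d (wact s) Z) r.
Proof.
rewrite inE /= => Cs hZ [s1 [s2 es]] hr hr' hrow hw Z0; move: Cs; rewrite {}es.
rewrite coeffs_in_cat coeffs_in_cons => -[C1 [CF C2]].
have hZ2 : minors_in (@nonneg R) k (act_from d (wact s2) Z).
  apply: minors_in_wact => //; first exact: subsemiring_nonneg.
  exact: coeffs_in_nonneg.
have -> : wact (s1 ++ F :: s2) = wact s1 \o (bact F \o wact s2).
  by apply/funext => x; rewrite wact_cat.
rewrite !act_from_comp; apply: rowminor_stay_gt0 => //.
  apply: minors_in_bact => //; first exact: subsemiring_nonneg.
  by move=> n; apply/ltW/CF.
apply: (rowminor_bact_gt0 (f := f)) => //; first exact: hw.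
rewrite (@eq_rowminor _ _ _ (act_from d (wact s2) Z) _ r'); first exact: rowminor_stay_gt0.
by move=> i j; rewrite hrow.
Qed.

Lemma type_word_split (A : Type) (s : seq (bidiag A)) t :
  t \in type_word s ->
  exists s1 F s2, is_lower F = t /\ s = s1 ++ F :: s2.
Proof.
elim: s => //= F s IH; rewrite inE => /orP[/eqP->|/IH[s1 [G [s2 [e ->]]]]].
  by exists [::], F, s.
by exists (F :: s1), G, s2.
Qed.

Lemma rowminor_down_gt0 (R : realDomainType) k (s : seq (bidiag R))
    (Z : nat -> nat -> R) :
  coeffs_in (@positive R) s -> true \in type_word s ->
  minors_in (@nonneg R) k Z -> 0 < rowminor Z (fun i : 'I_k => nat_of_ord i) ->
  0 < rowminor (act_from 0 (wact s) Z) (fun i : 'I_k => (nat_of_ord i).+1).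
Proof.
move=> Cs /type_word_split[s1 [F [s2 [FL es]]]] hZ Z0.
apply: (@rowminor_move_gt0 _ _ _ _ F _ _ (fun i => nat_of_ord i) (fun=> false)) => //.
- by rewrite inE; exists s1, s2.
- by case: F FL {es} => // l _ i /=.
- by case: F FL {es} => // l _ l0 i /=.
Qed.

Lemma rowminor_up_gt0 (R : realDomainType) k d (s : seq (bidiag R))
    (Z : nat -> nat -> R) :
  coeffs_in (@positive R) s -> false \in type_word s ->
  minors_in (@nonneg R) k Z ->
  0 < rowminor Z (fun i : 'I_k => if (i < d)%N then nat_of_ord i else i.+1) ->
  0 < rowminor (act_from d (wact s) Z) (fun i : 'I_k => nat_of_ord i).
Proof.
move=> Cs /type_word_split[s1 [F [s2 [FL es]]]] hZ Z0.
apply: (@rowminor_move_gt0 _ _ _ _ F _ _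
  (fun i => if (i < d)%N then nat_of_ord i else i.+1) (fun i => (i < d)%N)) => //.
- by rewrite inE; exists s1, s2.
- by move=> i j ij; do 2!case: ifP; lia.
- by case: F FL {es} => // u _ i /=; case: ltnP.
- by case: F FL {es} => // u _ u0 i /=; case: ltnP.
Qed.

(** A new column occupies row [0]; before it enters, a lower factor lifts the
    earlier ones from the rows [0, ..., k - 1] to the rows [1, ..., k]. *)
Lemma power_cols_gt0 (R : realDomainType) k (s : seq (bidiag R)) e :
  coeffs_in (@positive R) s -> true \in type_word s ->
  0 < rowminor (power_cols s (fun j => e + j)%N) (fun i : 'I_k => nat_of_ord i).
Proof.
move=> Cs sL; have Cs' := coeffs_in_nonneg Cs.
have nnR := @subsemiring_nonneg R.
elim: k e => [|k IH] e; first by rewrite /rowminor det_mx00.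
rewrite -power_cols_recl; last by move=> j; rewrite leq_add2l.
have incr i j : (i < j < k)%N -> (e + i.+1 - (e + 0) < e + j.+1 - (e + 0))%N by lia.
apply: rowminor_stay_iter_gt0 => //.
  by apply: minors_in_add_col; [exact: lexx|exact: minors_in_power_cols].
rewrite rowminor_add_col//=.
have -> : power_cols s (fun j => e + j.+1 - (e + 0))%N =
    act_from 0 (wact s) (power_cols s (fun j => 0 + j)%N).
  apply/funext => i; apply/funext => j; rewrite /act_from subn0 /power_cols.
  by rewrite (_ : e + j.+1 - (e + 0) = j.+1)%N//; lia.
rewrite (@eq_rowminor _ _ _ (act_from 0 (wact s) (power_cols s (fun j => 0 + j)%N))
  _ (fun i : 'I_k => (nat_of_ord i).+1))//.
apply: rowminor_down_gt0 => //; apply: minors_in_power_cols => // i j; lia.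
Qed.

(** The frozen row and its copy are equal; an upper factor separates them, since
    it expresses every moving row by the next one. *)
Lemma recorded_gt0 (R : realDomainType) k (s : seq (bidiag R))
    (Y : nat -> nat -> R) d :
  coeffs_in (@positive R) s -> false \in type_word s -> (d < k)%N ->
  minors_in (@nonneg R) k Y -> 0 < rowminor Y (fun i : 'I_k => nat_of_ord i) ->
  0 < rowminor (recorded s id Y d) (fun i : 'I_k => nat_of_ord i).
Proof.
move=> Cs sU + hY Y0; have Cs' := coeffs_in_nonneg Cs.
have nnR := @subsemiring_nonneg R.
elim: d => [|d IH] dk.
  rewrite (@eq_rowminor _ _ _ Y _ (fun i : 'I_k => nat_of_ord i))// => i j.
  by rewrite /recorded minn0 subn0.
have hZ : minors_in (@nonneg R) k (recorded s id Y d).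
  by apply: minors_in_recorded => //=; [move=> i j|]; lia.
rewrite recordedS// subSnn (_ : iter 1 (wact s) = wact s)//.
apply: rowminor_up_gt0 => //; first exact: minors_in_duplicate_row.
rewrite (@eq_rowminor _ _ _ (recorded s id Y d) _ (fun i : 'I_k => nat_of_ord i)).
  by apply: IH; lia.
move=> i j; rewrite /duplicate_row; congr recorded.
by case: (ltnP i d.+1); do ?case: ifP; lia.
Qed.

Lemma hankel_det_gt0 (R : realDomainType) (s : seq (bidiag R)) a b k e :
  coeffs_in (@positive R) s -> true \in type_word s -> false \in type_word s ->
  (1 <= a <= size s)%N -> (1 <= b <= size s)%N ->
  0 < \det (\matrix_(i < k, j < k) moment s a b (i + (e + j))%N).
Proof.
move=> Cs sL sU ha hb; have nnR := @subsemiring_nonneg R.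
have Csa := @coeffs_in_rot _ _ a.-1 _ Cs; have Csb := @coeffs_in_rot _ _ b.-1 _ Cs.
have rotE n : type_word (rot n s) = rot n (type_word s) by rewrite /type_word map_rot.
case: k => [|k]; first by rewrite det_mx00.
rewrite -(@recorded_hankel _ s a b k id (fun j => e + j)%N)//.
have hZ : minors_in (@nonneg R) k.+1 (power_cols (rot b.-1 s) (fun j => (e + j)%N)).
  apply: minors_in_power_cols => //; first exact: coeffs_in_nonneg.
  by move=> i j; lia.
apply: recorded_gt0 => //.
- by rewrite rotE mem_rot.
- apply: minors_in_wact => //; apply: coeffs_in_take; exact: coeffs_in_nonneg.
- apply: rowminor_stay_gt0 => //; first exact: coeffs_in_take.
  by apply: power_cols_gt0 => //; rewrite rotE mem_rot.
Qed.

(** * Polynomials in the generic coefficients *)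

Import -(notations) mpoly.

Definition map_bidiag (A B : Type) (f : A -> B) (F : bidiag A) : bidiag B :=
  match F with
  | Lower l => Lower (fun n => f (l n))
  | Upper u => Upper (fun n => f (u n))
  end.

Definition truncate_bidiag (A : comNzRingType) H (F : bidiag A) : bidiag A :=
  match F with
  | Lower l => Lower (fun n => l n *+ (n < H)%N)
  | Upper u => Upper (fun n => u n *+ (n < H)%N)
  end.

Lemma wact_rmorph (A B : comNzRingType) (f : {rmorphism A -> B})
    (s : seq (bidiag A)) (x : nat -> A) :
  wact (map (map_bidiag f) s) (fun i => f (x i)) = fun i => f (wact s x i).
Proof.
elim: s => //= F s ->; apply/funext => i.
case: F => [l|u] /=; last by rewrite rmorphD rmorphM.
by case: i => //= i; rewrite rmorphD rmorphM.
Qed.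

Lemma moment_rmorph (A B : comNzRingType) (f : {rmorphism A -> B})
    (s : seq (bidiag A)) a b k :
  moment (map (map_bidiag f) s) a b k = f (moment s a b k).
Proof.
rewrite !moment_wact size_map -!map_rot -map_take.
have -> : iter k (wact (map (map_bidiag f) (rot b.-1 s))) (@e0 B) =
    fun i => f (iter k (wact (rot b.-1 s)) (@e0 A) i).
  elim: k => [|k IH] /=; last by rewrite IH wact_rmorph.
  by apply/funext => i; rewrite /e0 rmorph_nat.
by rewrite wact_rmorph.
Qed.

(** Each factor looks at most one row further down, so the first entries of a
    product only depend on finitely many coefficients. *)
Lemma wact_truncate (A : comNzRingType) H (s : seq (bidiag A)) (x y : nat -> A) n :
  (n + size s <= H)%N -> (forall i, (i < n + size s)%N -> x i = y i) ->
  forall i, (i < n)%N -> wact (map (truncate_bidiag H) s) x i = wact s y i.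
Proof.
elim: s n => [|F s IH] n /=; first by rewrite addn0 => _ h i /h.
rewrite addnS -addSn => nH xy i ni.
have E j : (j < n.+1)%N -> wact (map (truncate_bidiag H) s) x j = wact s y j.
  exact: IH.
case: F => [l|u] /=; last by rewrite !E ?(leqW ni)// (_ : (i < H)%N) ?mulr1n//; lia.
case: i ni => [|i] ni; rewrite !E//; [|by lia..].
by rewrite (_ : (i < H)%N) ?mulr1n//; lia.
Qed.

Lemma moment_truncate (A : comNzRingType) H (s : seq (bidiag A)) a b k :
  (k.+1 * size s < H)%N -> moment (map (truncate_bidiag H) s) a b k = moment s a b k.
Proof.
move=> kH; rewrite !moment_wact size_map -!map_rot -map_take.
set d := cyclic_dist _ _ _.
have dM : (size (take d (rot a.-1 s)) <= size s)%N.
  by rewrite size_take size_rot; case: ifP => // /ltnW.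
have hk : forall n i, (i < n)%N -> (n + k * size s <= H)%N ->
    iter k (wact (map (truncate_bidiag H) (rot b.-1 s))) (@e0 A) i =
    iter k (wact (rot b.-1 s)) (@e0 A) i.
  elim: k {kH} => [//|k IH] n i ni nH /=.
  have e : (n + size s + k * size s = n + k.+1 * size s)%N by rewrite mulSn addnA.
  apply: (@wact_truncate _ _ _ _ _ n) => //; rewrite size_rot; first by lia.
  by move=> j jn; apply: (IH (n + size s)%N) => //; rewrite e.
apply: (@wact_truncate _ _ _ _ _ 1) => //; first by move: kH; rewrite mulSn; lia.
move=> i hi; apply: (hk (1 + size s)%N); last by move: kH; rewrite mulSn; lia.
by lia.
Qed.

Lemma subsemiring_nonneg_coefs N : subsemiring (@nonneg_coefs N).
Proof.
split.
- by move=> m; rewrite mcoeff0.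
- by move=> m; rewrite mcoeff1 ler0n.
- by move=> P Q hP hQ m; rewrite mcoeffD addr_ge0.
- by move=> P Q hP hQ m; rewrite mcoeffM sumr_ge0// => i _; rewrite mulr_ge0.
Qed.

Definition var_of N (M H : nat) (e : 'I_M * 'I_H -> 'I_N) (j n : nat) :
    mpoly N int :=
  match (insub j : option 'I_M), (insub n : option 'I_H) with
  | Some j', Some n' => mpolyX int (mnm1 (e (j', n')))
  | _, _ => 0
  end.

Definition bidiag_of (A : Type) (t : bool) (x : nat -> A) : bidiag A :=
  if t then Lower x else Upper x.

(** The polynomial is the minor of generic factors, whose coefficients are
    variables up to a large index and [0] beyond it. Ring morphisms commute
    with moments, and the truncation does not affect those that occur. *)
Lemma hankel_minor_polynomial (w : seq bool) a b k (r c : 'I_k -> nat) :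
  (1 <= a <= size w)%N -> (1 <= b <= size w)%N ->
  {homo r : i j / (i < j)%N} -> {homo c : i j / (i < j)%N} ->
  exists (N : nat) (v : 'I_N -> 'I_(size w) * nat) (Q : mpoly N int),
    nonneg_coefs Q /\
    forall (A : comNzRingType) (s : seq (bidiag A)),
      type_word s = w ->
      hankel_minor (moment s a b) r c = eval_coefs v Q s.
Proof.
move=> ha hb hr hc; set M := size w.
(* [K] bounds the indices of the moments involved, so that [K.+1 * M] bounds the
   number of factors in the corresponding products. *)
pose K := (\max_(i < k) r i + \max_(j < k) c j)%N.
pose H := (K.+1 * M).+1.
pose N := #|{: 'I_M * 'I_H}|.
pose v (i : 'I_N) : 'I_M * nat := let x := enum_val i in (x.1, nat_of_ord x.2).
pose X := @var_of N M H enum_rank.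
pose g := mkseq (fun j => bidiag_of (nth true w j) (X j)) M.
have sg : size g = M by rewrite size_mkseq.
exists N, v, (hankel_minor (moment g a b) r c); split.
  pose ext (h : 'I_k -> nat) i := if insub i is Some i' then h i' else 0%N.
  have extE h (i : 'I_k) : ext h i = h i by rewrite /ext valK.
  have exth (h : 'I_k -> nat) : {homo h : i j / (i < j)%N} ->
      forall i j, (i < j < k)%N -> (ext h i < ext h j)%N.
    move=> hh i j /andP[ij jk].
    rewrite -[i]/(val (Ordinal (ltn_trans ij jk))) -[j]/(val (Ordinal jk)) !extE.
    exact: hh.
  rewrite /hankel_minor (_ : \det _ =
      \det (\matrix_(i < k, j < k) moment g a b (ext r i + ext c j)%N)); last first.
    by congr (\det _); apply/matrixP => i j; rewrite !mxE !extE.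
  apply: hankel_minor_in; rewrite ?sg//;
    [exact: subsemiring_nonneg_coefs| |exact: (exth _ hr)|exact: (exth _ hc)].
  move=> i n; rewrite sg => iM; rewrite /coef nth_mkseq//.
  have -> : coeffs (bidiag_of (nth true w i) (X i)) = X i by case: nth.
  rewrite /X /var_of; case: insubP => [j _ _|_]; last by move=> m; rewrite mcoeff0.
  case: insubP => [l _ _|_] m; last by rewrite mcoeff0.
  by rewrite mcoeffX ler0n.
move=> A s sw.
have ss : size s = M by rewrite -(size_map (@is_lower A)) -/(type_word s) sw.
rewrite /eval_coefs; set f := mmap _ _.
have fs : map (map_bidiag f) g = map (truncate_bidiag H) s.
  apply: (@eq_from_nth _ (Lower (fun=> 0))); first by rewrite !size_map ss size_iota.
  move=> i; rewrite size_map sg => iM.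
  rewrite (nth_map (Lower (fun=> 0))) ?sg// (nth_map (Lower (fun=> 0))) ?ss//.
  rewrite nth_mkseq//.
  have fX n : f (X i n) = coef s i n *+ (n < H)%N.
    rewrite /X /var_of insubT /=; case: insubP => [n' nH n'E|nH].
      by rewrite /f mmapX mmap1U /v enum_rankK /= n'E nH.
    by rewrite /f mmap0 (negbTE nH).
  have : is_lower (nth (Lower (fun=> 0)) s i) = nth true w i.
    by rewrite -sw (nth_map (Lower (fun=> 0))) ?ss.
  have : coeffs (nth (Lower (fun=> 0)) s i) = coef s i by [].
  case: nth => x /= ex <- /=; congr (_ _); apply/funext => n; by rewrite fX ex.
pose f' : {rmorphism _ -> _} := [the {rmorphism mpoly N int -> A} of f].
transitivity (hankel_minor (moment (map (map_bidiag f') g) a b) r c); last first.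
  rewrite /hankel_minor -[RHS](det_map_mx f'); congr (\det _).
  by apply/matrixP => i j; rewrite !mxE moment_rmorph.
rewrite /hankel_minor; congr (\det _); apply/matrixP => i j; rewrite !mxE.
rewrite [map _ _]fs moment_truncate// ss /H ltnS leq_mul2r ltnS.
by apply/orP; right; rewrite leq_add// leq_bigmax.
Qed.

(** * Positivity of the refactorized factors *)

Lemma refactor_step_invariant (R : realType) (s t : seq (bidiag R)) :
  clos_refl_trans _ (@refactor_step R) s t -> coeffs_in (@positive R) s ->
  coeffs_in (@positive R) t /\ perm_eq (type_word s) (type_word t).
Proof.
elim => {s t} [s t []|s|s t u _ IH1 _ IH2].
- move=> s1 s2 u l l' u' l'0 u'0 _.
  rewrite !coeffs_in_cat !coeffs_in_cons => -[C1 [_ [_ C2]]]; split=> //.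
  rewrite /type_word !map_cat /= perm_cat2l.
  by apply/permP => P /=; rewrite addnCA.
- by move=> s0; split=> //; exact: perm_refl.
- by move=> /IH1[/IH2[? h2] h1]; split=> //; exact: perm_trans h2.
Qed.

Lemma factor_list_positive (R : realType) (p q : nat) (T : smatrix R)
    (L : 'I_p -> nat -> R) (U : 'I_q -> nat -> R) :
  (0 < p)%N -> (0 < q)%N ->
  positive_bidiagonal_factorization T L U ->
  [/\ coeffs_in (@positive R) (factor_list L U),
      true \in type_word (factor_list L U) &
      false \in type_word (factor_list L U)].
Proof.
move=> p0 q0 [L0 U0 _].
have pos (I : Type) (F : I -> bidiag R) (s : seq I) :
    (forall i n, 0 < coeffs (F i) n) -> coeffs_in (@positive R) (map F s).
  by move=> h; elim: s => //= x s IH; rewrite coeffs_in_cons; split=> // n; exact: h.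
split.
- by rewrite coeffs_in_cat; split; apply: pos => i n; [exact: L0|exact: U0].
- rewrite /type_word map_cat mem_cat -!map_comp; apply/orP; left.
  by apply/mapP; exists (Ordinal p0); rewrite ?mem_enum.
- rewrite /type_word map_cat mem_cat -!map_comp; apply/orP; right.
  by apply/mapP; exists (Ordinal q0); rewrite ?mem_enum.
Qed.

Lemma refactorized_positive (R : realType) (p q : nat) (T : smatrix R)
    (L : 'I_p -> nat -> R) (U : 'I_q -> nat -> R) a0 Ft :
  (0 < p)%N -> (0 < q)%N -> positive_bidiagonal_factorization T L U ->
  refactorized L U a0 Ft ->
  [/\ coeffs_in (@positive R) Ft, true \in type_word Ft,
      false \in type_word Ft & size Ft = (p + q)%N].
Proof.
move=> p0 q0 hT [steps w]; have [C0 tL tU] := factor_list_positive p0 q0 hT.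
have [CF peq] := refactor_step_invariant steps (coeffs_in_rot (n := a0.-1) C0).
split=> //.
- by rewrite -(perm_mem peq) /type_word map_rot mem_rot.
- by rewrite -(perm_mem peq) /type_word map_rot mem_rot.
- by rewrite -(size_map (@is_lower R)) -/(type_word Ft) w size_mkseq.
Qed.

(** * Positive definiteness of the moment functional *)

(** One step of Gaussian elimination: the Schur complement of the first entry
    appears. *)
Lemma det_schur_step (R : fieldType) (H : nat -> nat -> R) k :
  H 0%N 0%N != 0 ->
  \det (\matrix_(i < k.+1, j < k.+1) H i j) = H 0%N 0%N *
  \det (\matrix_(i < k, j < k) (H i.+1 j.+1 - H i.+1 0%N * H 0%N j.+1 / H 0%N 0%N)).
Proof.
move=> h0; set D := \matrix_(i < k, j < k) _.
pose b : 'rV[R]_k := \row_j H 0%N j.+1.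
pose c : 'cV[R]_k := \col_i (H i.+1 0%N / H 0%N 0%N).
have -> : (\matrix_(i < k.+1, j < k.+1) H i j) =
    (block_mx 1%:M 0 c 1%:M : 'M[R]_(1 + k)) *m block_mx (H 0%N 0%N)%:M b 0 D.
  rewrite mulmx_block !mul0mx !mul1mx !addr0.
  rewrite -[LHS](@submxK _ 1 k 1 k); f_equal; apply/matrixP => i j.
  - by rewrite !mxE !ord1 eqxx.
  - by rewrite !mxE !ord1.
  - by rewrite !mxE big_ord1 !mxE !ord1 eqxx mulr1n divfK.
  - by rewrite !mxE big_ord1 !mxE /=; field.
by rewrite det_mulmx (@det_lblock _ 1 k) (@det_ublock _ 1 k) !det1 det_scalar1 !mul1r.
Qed.

(** Completing the square in the first variable leaves the form of the Schur
    complement, whose leading determinants are those of [H] divided by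
    [H 0 0]. *)
Lemma leading_dets_posdef (R : realFieldType) k (H : nat -> nat -> R) (x : nat -> R) :
  (forall i j, H i j = H j i) ->
  (forall j, (0 < j <= k)%N -> 0 < \det (\matrix_(a < j, b < j) H a b)) ->
  (exists2 i, (i < k)%N & x i != 0) ->
  0 < \sum_(i < k) \sum_(j < k) x i * x j * H i j.
Proof.
elim: k H x => [|k IH] H x Hs Hd; first by case.
have h0 : 0 < H 0%N 0%N by have := Hd 1%N isT; rewrite det_mx11 mxE.
have h0' : H 0%N 0%N != 0 by rewrite gt_eqF.
pose H' i j := H i.+1 j.+1 - H i.+1 0%N * H 0%N j.+1 / H 0%N 0%N.
pose y := \sum_(j < k) x j.+1 * H 0%N j.+1.
have -> : \sum_(i < k.+1) \sum_(j < k.+1) x i * x j * H i j =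
    (x 0%N * H 0%N 0%N + y) ^+ 2 / H 0%N 0%N +
    \sum_(i < k) \sum_(j < k) x i.+1 * x j.+1 * H' i j.
  have -> : \sum_(i < k) \sum_(j < k) x i.+1 * x j.+1 * H' i j =
      \sum_(i < k) \sum_(j < k) x i.+1 * x j.+1 * H i.+1 j.+1 - y * y / H 0%N 0%N.
    rewrite /y -mulrA mulr_suml -sumrB; apply: eq_bigr => i _.
    rewrite mulrA mulr_sumr mulr_suml -sumrB; apply: eq_bigr => j _.
    by rewrite /H' (Hs i.+1 0%N); field.
  rewrite big_ord_recl [X in X + _]big_ord_recl.
  under [X in _ + X = _]eq_bigr => i _ do rewrite big_ord_recl.
  rewrite [X in _ + X = _]big_split /=.
  have -> : \sum_(i < k) x 0%N * x (bump 0 i) * H 0%N (bump 0 i) = x 0%N * y.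
    by rewrite /y mulr_sumr; apply: eq_bigr => i _; rewrite /bump /=; ring.
  have -> : \sum_(i < k) x (bump 0 i) * x 0%N * H (bump 0 i) 0%N = x 0%N * y.
    rewrite /y mulr_sumr; apply: eq_bigr => i _.
    by rewrite /bump /= add1n (Hs i.+1 0%N); ring.
  have -> : \sum_(i < k) \sum_(j < k)
      x (bump 0 i) * x (bump 0 j) * H (bump 0 i) (bump 0 j) =
      \sum_(i < k) \sum_(j < k) x i.+1 * x j.+1 * H i.+1 j.+1 by [].
  by field.
have sq0 : 0 <= (x 0%N * H 0%N 0%N + y) ^+ 2 / H 0%N 0%N.
  by rewrite divr_ge0 ?sqr_ge0// ltW.
have H's i j : H' i j = H' j i.
  by rewrite /H' (Hs i.+1 j.+1) (Hs i.+1 0%N) (Hs 0%N j.+1); ring.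
have H'd j : (0 < j <= k)%N -> 0 < \det (\matrix_(a < j, b < j) H' a b).
  move=> /andP[j0 jk]; have := Hd j.+1 jk.
  by rewrite det_schur_step// pmulr_rgt0.
have [/existsP[i xi] _|/existsPn x0 [[|i] ik xi]] :=
  boolP [exists i : 'I_k, x i.+1 != 0].
- by rewrite ltr_wpDl// (IH H' (fun i => x i.+1))//; exists i.
- have z (j : 'I_k) : x j.+1 = 0 by apply/eqP; rewrite -[_ == _]negbK x0.
  have -> : y = 0 by rewrite /y big1// => j _; rewrite z mul0r.
  rewrite big1 => [|j _]; last by rewrite big1// => l _; rewrite z !mul0r.
  by rewrite !addr0 divr_gt0// exprn_even_gt0// mulf_neq0.
- by have := x0 (Ordinal (ik : (i < k)%N)); rewrite xi.
Qed.

Definition moment_functional (R : nzRingType) (m : nat -> R) (p : {poly R}) : R :=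
  \sum_(i < size p) p`_i * m i.

Lemma moment_functionalE (R : nzRingType) (m : nat -> R) n (p : {poly R}) :
  (size p <= n)%N -> moment_functional m p = \sum_(i < n) p`_i * m i.
Proof.
move=> pn; rewrite /moment_functional (big_ord_widen _ (fun i => p`_i * m i) pn).
rewrite big_mkcond; apply: eq_bigr => i _.
by case: ltnP => // pi; rewrite nth_default ?mul0r.
Qed.

Lemma moment_functional_is_scalar (R : nzRingType) (m : nat -> R) :
  scalar (moment_functional m).
Proof.
move=> a p q; set n := maxn (size p) (size q).
have pn : (size p <= n)%N by rewrite leq_maxl.
have qn : (size q <= n)%N by rewrite leq_maxr.
rewrite !(@moment_functionalE _ _ n)//; last first.
  by rewrite (leq_trans (size_polyD _ _))// geq_max qn (leq_trans (size_scale_leq _ _)).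
rewrite mulr_sumr -big_split; apply: eq_bigr => i _ /=.
by rewrite coefD coefZ mulrDl mulrA.
Qed.

HB.instance Definition _ (R : nzRingType) (m : nat -> R) :=
  GRing.isLinear.Build R {poly R} R *%R (moment_functional m)
    (moment_functional_is_scalar m).

Lemma moment_functionalXn (R : nzRingType) (m : nat -> R) n :
  moment_functional m 'X^n = m n.
Proof.
rewrite /moment_functional size_polyXn big_ord_recr big1 => [|i _] /=.
  by rewrite coefXn eqxx mul1r add0r.
by rewrite coefXn ltn_eqF// mul0r.
Qed.

Lemma moment_functionalM (R : comNzRingType) (m : nat -> R) (p q : {poly R}) :
  moment_functional m (p * q) =
  \sum_(i < size p) \sum_(j < size q) p`_i * q`_j * m (i + j)%N.
Proof.
rewrite -{1}[p]coefK -{1}[q]coefK !poly_def mulr_suml linear_sum.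
apply: eq_bigr => i _; rewrite mulr_sumr linear_sum; apply: eq_bigr => j _.
by rewrite -scalerAl -scalerAr -exprD 2!linearZ /= moment_functionalXn mulrA.
Qed.

Lemma moment_functional_mulX (R : comNzRingType) (m : nat -> R) (p : {poly R}) :
  moment_functional m ('X * p) = moment_functional (fun i => m i.+1) p.
Proof.
rewrite -{1}[p]coefK poly_def mulr_sumr linear_sum; apply: eq_bigr => i _.
by rewrite -scalerAr -exprS linearZ /= moment_functionalXn.
Qed.

Lemma moment_functional_sqr_gt0 (R : realFieldType) (m : nat -> R) (p : {poly R}) :
  (forall k, (0 < k)%N -> 0 < \det (\matrix_(r < k, c < k) m (r + c)%N)) ->
  p != 0 -> 0 < moment_functional m (p ^+ 2).
Proof.
move=> md p0; rewrite expr2 moment_functionalM.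
apply: (@leading_dets_posdef _ _ (fun i j => m (i + j)%N) (fun i => p`_i)).
- by move=> i j; rewrite addnC.
- by move=> j /andP[j0 _]; exact: md.
- exists (size p).-1; first by rewrite prednK// lt0n size_poly_eq0.
  by rewrite -/(lead_coef p) lead_coef_eq0.
Qed.

(** * Polynomials that are nonnegative on the half line *)

Lemma poly_coercive (R : realFieldType) (p : {poly R}) (C : R) :
  (1 < size p)%N -> 0 < lead_coef p ->
  exists2 B : R, 0 <= B & forall x, B <= x -> C <= p.[x].
Proof.
elim/poly_ind: p C => [C|p c IH C]; first by rewrite size_poly0.
have [->|p0] := eqVneq p 0.
  by rewrite mul0r add0r => /leq_trans/(_ (size_polyC_leq1 c)).
move=> _; rewrite lead_coefDl ?lead_coefMX; last first.
  by rewrite size_mulX// (leq_ltn_trans (size_polyC_leq1 c))// ltnS size_poly_gt0.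
move=> lp; have [sp|sp] := leqP (size p) 1.
  have pE := size1_polyC sp; have a0 : 0 < p`_0.
    by move: lp; rewrite {1}pE lead_coefC.
  exists (`|C - c| / p`_0) => [|x hx]; first by rewrite divr_ge0// ltW.
  rewrite hornerMXaddC {1}pE hornerC -lerBlDr mulrC.
  by rewrite (le_trans (ler_norm _))// -ler_pdivrMr.
have [B B0 hB] := IH 1 sp lp.
exists (Num.max B `|C - c|) => [|x]; first by rewrite le_max B0.
rewrite ge_max hornerMXaddC -lerBlDr => /andP[Bx Cx].
rewrite (le_trans (ler_norm _))// (le_trans Cx)//.
by rewrite ler_peMl ?hB// (le_trans B0).
Qed.

Lemma poly_ge0_right (R : realType) (p : {poly R}) t :
  (forall x, t < x -> 0 <= p.[x]) -> 0 <= p.[t].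
Proof.
move=> h; have : horner p x @[x --> t^'+] --> p.[t].
  by apply: cvg_at_right_filter; exact: continuous_horner.
move/cvgr_to_ge; apply; near=> x; apply: h.
by near: x; exact: nbhs_right_gt.
Unshelve. all: by end_near. Qed.

Lemma poly_le0_left (R : realType) (p : {poly R}) t : 0 < t ->
  (forall x, 0 <= x < t -> p.[x] <= 0) -> p.[t] <= 0.
Proof.
move=> t0 h; have : horner p x @[x --> t^'-] --> p.[t].
  by apply: cvg_at_left_filter; exact: continuous_horner.
move/cvgr_to_le; apply; near=> x; apply: h; apply/andP; split.
  by apply/ltW; near: x; exact: nbhs_left_gt.
by near: x; exact: nbhs_left_lt.
Unshelve. all: by end_near. Qed.

Lemma poly_min_halfline (R : realType) (p : {poly R}) :
  (1 < size p)%N -> (forall x, 0 <= x -> 0 <= p.[x]) ->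
  exists2 t, 0 <= t & forall x, 0 <= x -> p.[t] <= p.[x].
Proof.
move=> sp hp.
have lp : 0 < lead_coef p.
  rewrite lt_neqAle eq_sym lead_coef_eq0 -size_poly_gt0 (ltn_trans _ sp)//=.
  rewrite leNgt; apply/negP => lp.
  have [B B0 hB] : exists2 B, 0 <= B & forall x, B <= x -> 1 <= (- p).[x].
    by apply: poly_coercive; rewrite ?size_polyN ?lead_coefN ?oppr_gt0.
  have := hB B (lexx _); rewrite hornerN => h; have := hp B B0; lra.
have [B B0 hB] := poly_coercive p.[0] sp lp.
have cp : {within `[0, B], continuous (horner p)}.
  by apply: continuous_subspaceT => x; exact: continuous_horner.
have [t] := EVT_min B0 cp; rewrite in_itv /= => /andP[t0 tB] ht.
exists t => // x x0; have [xB|/ltW Bx] := leP x B.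
  by apply: ht; rewrite in_itv /= x0.
by rewrite (le_trans _ (hB x Bx))// ht// in_itv /= lexx.
Qed.

(** Subtracting its minimum on the half line leaves a polynomial with a root
    there, simple if it is [0] and double otherwise. Dividing it out lowers the
    degree, and multiplying the argument of [L] by ['X] or by [('X - t) ^ 2]
    preserves both hypotheses on [L]. *)
Lemma halfline_functional_ge0 (R : realType) (L : {scalar {poly R}}) (p : {poly R}) :
  (forall f, 0 <= L (f ^+ 2)) -> (forall f, 0 <= L ('X * f ^+ 2)) ->
  (forall x, 0 <= x -> 0 <= p.[x]) -> 0 <= L p.
Proof.
have [n] := ubnP (size p); elim: n => // n IH in L p *; rewrite ltnS => pn L0 LX hp.
have Lc c : 0 <= c -> 0 <= L c%:P.
  move=> c0; rewrite -alg_polyC.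
  rewrite linearZ /= mulr_ge0//.
  by have := L0 1; rewrite expr1n.
have [sp|sp] := leqP (size p) 1.
  rewrite (size1_polyC sp); apply: Lc.
  by have := hp 0 (lexx _); rewrite horner_coef0.
have [t t0 ht] := poly_min_halfline sp hp.
pose q := p - (p.[t])%:P.
have hq x : 0 <= x -> 0 <= q.[x] by move=> x0; rewrite /q !hornerE subr_ge0 ht.
have qt : q.[t] = 0 by rewrite /q !hornerE subrr.
have sq : size q = size p.
  by rewrite /q size_polyDl// size_polyN (leq_ltn_trans (size_polyC_leq1 _)).
have -> : p = q + (p.[t])%:P by rewrite /q subrK.
rewrite linearD /= addr_ge0//; last by apply: Lc; exact: hp.
have [q1 qE] : exists q1, q = q1 * ('X - t%:P) by apply/factor_theorem/rootP.
have q0 : q != 0 by rewrite -size_poly_gt0 sq (ltn_trans _ sp).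
have q10 : q1 != 0 by apply: contra_neq q0 => e; rewrite qE e mul0r.
have sq1 : (size q1).+1 = size p by rewrite -sq qE size_Mmonic ?monicXsubC// size_XsubC addn2.
have q1r x : 0 <= x -> t < x -> 0 <= q1.[x].
  move=> x0 tx; have := hq x x0.
  by rewrite qE hornerM hornerXsubC pmulr_lge0// subr_gt0.
have q1t : 0 <= q1.[t].
  by apply: poly_ge0_right => x tx; apply: q1r => //; rewrite (le_trans t0)// ltW.
move: t0; rewrite le_eqVlt => /orP[/eqP t0|t0].
  move: qE q1r q1t; rewrite -{}t0 subr0 mulrC => -> q1r q1t.
  pose L' : {scalar {poly R}} := [the {scalar {poly R}} of L \o ('X \*o idfun)].
  apply: (IH L' q1); first by rewrite -ltnS sq1.
  - by move=> f; exact: LX.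
  - by move=> f; rewrite /= mulrA -expr2 -exprMn; exact: L0.
  - move=> x; rewrite le_eqVlt => /orP[/eqP<-//|x0]; apply: q1r => //; exact: ltW.
have q1t0 : q1.[t] = 0.
  apply: le_anti; rewrite q1t andbT; apply: poly_le0_left => // x /andP[x0 xt].
  have := hq x x0; rewrite qE hornerM hornerXsubC nmulr_lge0// subr_lt0//.
have [q2 q2E] : exists q2, q1 = q2 * ('X - t%:P) by apply/factor_theorem/rootP.
have sq2 : (size q2).+1 = size q1.
  have q20 : q2 != 0 by apply: contra_neq q10 => e; rewrite q2E e mul0r.
  by rewrite q2E size_Mmonic ?monicXsubC// size_XsubC addn2.
have q2r x : 0 <= x -> x != t -> 0 <= q2.[x].
  move=> x0 xt; have := hq x x0.
  rewrite qE q2E -mulrA -expr2 hornerM horner_exp hornerXsubC pmulr_lge0//.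
  by rewrite exprn_even_gt0//= subr_eq0.
have q2t : 0 <= q2.[t].
  apply: poly_ge0_right => x tx; apply: q2r; last by rewrite gt_eqF.
  by rewrite ltW// (lt_trans t0).
pose L' : {scalar {poly R}} :=
  [the {scalar {poly R}} of L \o ((('X - t%:P) ^+ 2) \*o idfun)].
have -> : q = ('X - t%:P) ^+ 2 * q2 by rewrite qE q2E; ring.
apply: (IH L' q2); first by rewrite (leq_trans _ pn)// -sq1 -sq2.
- by move=> f; rewrite /= -exprMn; exact: L0.
- by move=> f; rewrite /= mulrCA -exprMn; exact: LX.
- by move=> x x0; have [->//|xt] := eqVneq x t; exact: q2r.
Qed.

(** * Extension of the functional to indicators of rays *)

(** The graph of a positive linear functional extending [L]. Its domain varies,
    which is why it is a set of pairs. *)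
Definition positive_extension (R : realType) (L : {poly R} -> R)
    (G : set ((R -> R) * R)) : Prop :=
  [/\ forall p, G (horner p, L p),
      forall a u v, G u -> G v ->
        G (fun x => a * u.1 x + v.1 x, a * u.2 + v.2) &
      forall u, G u -> (forall x, 0 <= x -> 0 <= u.1 x) -> 0 <= u.2].

Lemma positive_extension_scale (R : realType) (L : {scalar {poly R}}) G a f c :
  positive_extension L G -> G (f, c) -> G (fun x => a * f x, a * c).
Proof.
move=> [Gp Gl _] Gf; have := Gl a _ _ Gf (Gp 0).
rewrite /= linear0 addr0; congr (G (_, _)).
by apply/funext => x; rewrite horner0 addr0.
Qed.

Lemma positive_extension_le (R : realType) (L : {scalar {poly R}}) G f g c d :
  positive_extension L G -> G (f, c) -> G (g, d) ->
  (forall x, 0 <= x -> f x <= g x) -> c <= d.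
Proof.
move=> [_ Gl G0] Gf Gg fg.
rewrite -subr_ge0 addrC -mulN1r.
by apply: (G0 _ (Gl (-1) _ _ Gf Gg)) => x x0 /=; rewrite mulN1r addrC subr_ge0 fg.
Qed.

(** The value at the new function is the supremum of the values of its
    minorants. *)
Lemma positive_extension_step (R : realType) (L : {scalar {poly R}}) G (e : R -> R) :
  positive_extension L G -> (forall x, 0 <= e x <= 1) ->
  exists v G', [/\ positive_extension L G', G `<=` G' & G' (e, v)].
Proof.
move=> hG he; have [Gp Gl G0] := hG.
pose low := [set c | exists f, G (f, c) /\ forall x, 0 <= x -> f x <= e x].
have low_le g d : G (g, d) -> (forall x, 0 <= x -> e x <= g x) -> ubound low d.
  move=> Gg eg c [f [Gf fe]]; apply: (positive_extension_le hG Gf Gg) => x x0.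
  exact: le_trans (fe _ x0) (eg _ x0).
have low0 : low !=set0.
  exists (L 0), (horner 0); split; first exact: Gp.
  by move=> x _; rewrite horner0; case/andP: (he x).
have lowb : has_sup low.
  split=> //; exists (L 1); apply: (low_le (horner 1)); first exact: Gp.
  by move=> x _; rewrite hornerC; case/andP: (he x).
pose v := sup low.
pose G' := [set w : (R -> R) * R | exists a u, G u /\
  w = (fun x => a * e x + u.1 x, a * v + u.2)].
have GG' : G `<=` G'.
  move=> [f c] Gf; exists 0, (f, c); split=> //=; congr (_, _); last by rewrite mul0r add0r.
  by apply/funext => x; rewrite mul0r add0r.
exists v, G'; split=> //; last first.
  exists 1, (horner 0, L 0); split; first exact: Gp.
  congr (_, _); last by rewrite /= linear0 mul1r addr0.
  by apply/funext => x /=; rewrite horner0 mul1r addr0.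
split=> [p|a _ _ [b [u [Gu ->]]] [c [w [Gw ->]]]|_ [a [[f d] [Gf ->]]] /= hf].
- exact/GG'/Gp.
- exists (a * b + c), (fun x => a * u.1 x + w.1 x, a * u.2 + w.2); split; first exact: Gl.
  by congr (_, _); [apply/funext => x /=; ring|rewrite /=; ring].
have [a0|a0|a0] := ltgtP a 0.
- have E (x y : R) : (0 <= a * x + y) = (x <= - a^-1 * y).
    have -> : a * x + y = (- a) * (- a^-1 * y - x) by field; rewrite lt_eqF.
    by rewrite pmulr_rge0 ?oppr_gt0// subr_ge0.
  rewrite E; apply: ge_sup => //; apply: (low_le (fun x => - a^-1 * f x)).
    exact: positive_extension_scale.
  by move=> x x0; rewrite -E; exact: hf.
- have E (x y : R) : (0 <= a * x + y) = (- a^-1 * y <= x).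
    have -> : a * x + y = a * (x - - a^-1 * y) by field; rewrite gt_eqF.
    by rewrite pmulr_rge0// subr_ge0.
  rewrite E; apply: ub_le_sup; first by case: lowb.
  exists (fun x => - a^-1 * f x); split; first exact: positive_extension_scale.
  by move=> x x0; rewrite -E; exact: hf.
- rewrite a0 mul0r add0r; apply: (G0 _ Gf) => x x0 /=.
  by have := hf x x0; rewrite a0 mul0r add0r.
Qed.

Lemma maximal_positive_extension (R : realType) (L : {scalar {poly R}}) :
  (forall p, (forall x, 0 <= x -> 0 <= p.[x]) -> 0 <= L p) ->
  exists2 G, positive_extension L G &
    forall e : R -> R, (forall x, 0 <= e x <= 1) -> exists v, G (e, v).
Proof.
(* The empty graph is admitted as the union of the empty chain. *)
move=> L0; pose P (A : set ((R -> R) * R)) := A = set0 \/ positive_extension L A.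
pose G0 := [set w : (R -> R) * R | exists p, w = (horner p, L p)].
have PG0 : positive_extension L G0.
  split=> [p|a _ _ [p ->] [q ->]|_ [p ->] /=]; first by exists p.
    exists (a *: p + q); congr (_, _); last by rewrite linearP.
    by apply/funext => x /=; rewrite hornerD hornerZ.
  exact: L0.
have [|A [PA Amax]] := @Zorn_bigcup _ P.
  move=> F FP Ft; have [F0|/existsNP[X0 /not_implyP[FX0 X0n]]] :=
    pselect (forall X, F X -> X = set0).
    by left; rewrite -subset0 => u [X FX]; rewrite (F0 _ FX).
  right; have hX X u : F X -> X u -> positive_extension L X.
    by move=> FX Xu; case: (FP _ FX) => // X0'; rewrite X0' in Xu.
  have [Xp _ _] : positive_extension L X0 by case: (FP _ FX0).
  split=> [p|a u v [X FX Xu] [Y FY Yv]|u [X FX Xu]].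
  - by exists X0.
  - have [XY|YX] := Ft _ _ FX FY.
      have [_ h _] := hX _ _ FY Yv; exists Y => //; apply: h => //; exact: XY.
    have [_ h _] := hX _ _ FX Xu; exists X => //; apply: h => //; exact: YX.
  - by have [_ _ h] := hX _ _ FX Xu; exact: h.
have {}PA : positive_extension L A.
  case: PA => // A0; exfalso; apply: (Amax G0); last by right.
  rewrite A0; split=> // /(_ (horner 0, L 0)); apply.
  by exists 0.
exists A => // e he; have [v [G' [PG' AG' G'e]]] := positive_extension_step PA he.
exists v; apply: contrapT => nAe; apply: (Amax G'); last by right.
by split=> // /(_ _ G'e).
Qed.

(** M. Riesz' extension theorem for the indicators of the rays: [S t] plays the
    role of the mass of the ray beyond [t], up to the mass of its end point. *)
Lemma tail_values (R : realType) (L : {scalar {poly R}}) :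
  (forall p, (forall x, 0 <= x -> 0 <= p.[x]) -> 0 <= L p) ->
  exists S : R -> R, forall (p : {poly R}) (s : seq (R * R)),
    (forall x, 0 <= x -> 0 <= p.[x] + \sum_(a <- s) a.1 * (a.2 < x)%R%:R) ->
    0 <= L p + \sum_(a <- s) a.1 * S a.2.
Proof.
move=> /maximal_positive_extension[G [Gp Gl G0] hG].
have [S hS] : {S : R -> R & forall t, G (fun x => (t < x)%R%:R, S t)}.
  apply: (@choice _ _ (fun t v => G (fun x => (t < x)%R%:R, v))) => t.
  by apply: hG => x; case: (t < x)%R; rewrite /= ?lexx ler01.
exists S => p s; suff : G (fun x => p.[x] + \sum_(a <- s) a.1 * (a.2 < x)%R%:R,
    L p + \sum_(a <- s) a.1 * S a.2) by move=> /G0.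
elim: s => [|a s IH].
  have := Gp p; congr (G (_, _)); last by rewrite big_nil addr0.
  by apply/funext => x; rewrite big_nil addr0.
have := Gl a.1 _ _ (hS a.2) IH; congr (G (_, _)); last by rewrite big_cons /=; ring.
by apply/funext => x; rewrite big_cons /=; ring.
Qed.

(** * A measure with prescribed tails *)

(** The quantile transform: the measure is the image of the Lebesgue measure on
    the interval from [0] to [m0] by the generalized inverse [Q] of [S]. The
    jumps of [S] account for the shift from [s] to [t] in the last bound. *)
Lemma measure_of_tails (R : realType) (S : R -> R) (m0 m1 : R) :
  (forall t, 0 <= S t <= m0) -> {homo S : s t / s <= t >-> t <= s} ->
  (forall t, 0 <= t -> t * S t <= m1) ->
  exists rho : {measure set (measurableTypeR R) -> \bar R},
    [/\ rho `]-oo, 0%R[%classic = 0%E, rho setT = m0%:E,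
        forall t, 0 <= t -> (rho `]t, +oo[%classic <= (S t)%:E)%E &
        forall s t, 0 <= s -> s < t -> ((S t)%:E <= rho `]s, +oo[%classic)%E].
Proof.
move=> S0 Sni St; pose E (u : R) : set R := [set t | [/\ 0 <= t, 0 < u & u < S t]].
pose Q (u : R) : R := sup (E u).
(* The bound on [t * S t] keeps [Q u] finite. *)
have Eub u : 0 < u -> ubound (E u) (m1 / u).
  move=> u0 t [t0 _ ut]; rewrite ler_pdivlMr// (le_trans _ (St t t0))//.
  by rewrite ler_wpM2l// ltW.
have Esup u : E u !=set0 -> has_sup (E u).
  by move=> E0; split=> //; case: E0 => t [_ u0 _]; exists (m1 / u); exact: Eub.
have E0 u : ~ (E u !=set0) -> Q u = 0.
  by move=> /set0P/negP/negPn/eqP e; rewrite /Q e sup0.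
have Q0 u : 0 <= Q u.
  have [/[dup] h [t /[dup] Et [t0 _ _]]|/E0->//] := pselect (E u !=set0).
  by rewrite (le_trans t0)//; apply: (sup_upper_bound (Esup _ h)).
have Qgt u t : 0 <= t -> t < Q u <-> 0 < u /\ exists2 s, t < s & u < S s.
  move=> t0; split=> [tQ|[u0 [s ts us]]]; last first.
    have Es : E u s by split=> //; rewrite (le_trans t0)// ltW.
    by rewrite (lt_le_trans ts)//; apply: sup_upper_bound => //; apply: Esup; exists s.
  have [Eu|/E0 Qu] := pselect (E u !=set0); last by rewrite Qu ltNge t0 in tQ.
  have tQ' : 0 < Q u - t by rewrite subr_gt0.
  have [s [s0 u0 us]] := sup_adherent tQ' (Esup _ Eu).
  by rewrite -/(Q u) subKr => ts; split=> //; exists s.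
have mQ : measurable_fun [set: measurableTypeR R] (Q : measurableTypeR R -> measurableTypeR R).
  apply: (measurability (@RGenOInfty.G R)); first exact: RGenOInfty.measurableE.
  move=> _ [_ [x ->] <-]; rewrite setTI; apply: is_interval_measurable.
  move=> u1 u2 /=; rewrite !in_itv /= !andbT => h1 h2 u /andP[u1u uu2].
  rewrite in_itv /= andbT; have [x0|x0] := ltP x 0; first exact: lt_le_trans (Q0 u).
  move: h1 h2 => /(Qgt _ _ x0)[u10 _] /(Qgt _ _ x0)[_ [s xs us]].
  by apply/Qgt => //; split; [exact: lt_le_trans u1u|exists s => //; exact: le_lt_trans us].
have mD : measurable (`]0, m0[%classic : set (measurableTypeR R)) by exact: measurable_itv.
pose lam := mrestr (@lebesgue_measure R) mD.
have m00 : 0 <= m0 by have /andP[] := S0 0; exact: le_trans.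
have lamI (x : R) : 0 <= x -> lebesgue_measure (`]0, x[%classic : set R) = x%:E.
  move=> x0; rewrite lebesgue_measure_itv/= lte_fin.
  case: ltP => [_|x0']; first by rewrite sube0.
  by rewrite (@le_anti _ _ x 0)// x0 x0'.
pose rho := [the {measure set (measurableTypeR R) -> \bar R} of
  pushforward lam (Q : measurableTypeR R -> measurableTypeR R)].
have rhoE A : rho mQ A = lebesgue_measure (Q @^-1` A `&` `]0, m0[%classic) by [].
have mpre (A : set (measurableTypeR R)) : measurable A ->
    measurable (Q @^-1` A `&` `]0, m0[%classic : set (measurableTypeR R)).
  move=> mA; apply: measurableI => //.
  by rewrite -[X in measurable X]setTI; exact (mQ measurableT _ mA).
have mray (x : R) : measurable (`]x, +oo[%classic : set (measurableTypeR R)).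
  exact: measurable_itv.
exists (rho mQ); split.
- rewrite rhoE (_ : _ `&` _ = set0) ?measure0// -subset0 => u [] /=.
  by rewrite in_itv /= ltNge Q0.
- by rewrite rhoE preimage_setT setTI lamI.
- move=> t t0; have /andP[St0 _] := S0 t.
  rewrite rhoE -lamI//; apply: le_measure; rewrite ?inE; [exact: mpre|exact: measurable_itv|].
  move=> u [] /=; rewrite !in_itv /= andbT => /(Qgt _ _ t0)[u0 [s ts us]] _.
  by rewrite u0 (lt_le_trans us)// Sni// ltW.
- move=> s t s0 st; have /andP[St0 Sm0] := S0 t.
  rewrite rhoE -lamI//; apply: le_measure; rewrite ?inE; [exact: measurable_itv|exact: mpre|].
  move=> u /=; rewrite !in_itv /= andbT => /andP[u0 ut]; split.
    by apply/Qgt => //; split=> //; exists t.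
  by rewrite u0 (lt_le_trans ut).
Qed.

(** * Riemann sums of powers *)

Lemma expr_diff_le (R : realDomainType) (x y : R) k : 0 <= y -> y <= x ->
  x ^+ k.+1 - y ^+ k.+1 <= k.+1%:R * x ^+ k * (x - y).
Proof.
move=> y0 yx; have x0 : 0 <= x by exact: le_trans yx.
elim: k => [|k IH]; first by rewrite !expr1 expr0 !mul1r.
have h1 := ler_wpM2r x0 IH.
have h2 : y ^+ k.+1 * (x - y) <= x ^+ k.+1 * (x - y).
  by rewrite ler_wpM2r ?subr_ge0// lerXn2r.
rewrite -(natr1 k.+1) (exprSr x k.+1) (exprSr y k.+1) (exprSr x k).
move: h1 h2; rewrite (exprSr x k); set u := x ^+ k; set v := y ^+ k.+1.
by nra.
Qed.

(** For tails [f], the integral of a step function with the increments of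
    [(i / n) ^ k] along the grid, where the jump to the value at node [i.+1]
    takes place at node [i + e]. For [f] the indicator of the nodes below [x],
    it is the value of this step function at [x]. *)
Definition ray_sum (R : numFieldType) (n k e N : nat) (f : R -> R) : R :=
  \sum_(i < N) ((i.+1%:R / n%:R) ^+ k - (i%:R / n%:R) ^+ k) * f ((i + e)%:R / n%:R).

Lemma grid_mono (R : realFieldType) n i j : (0 < n)%N -> (i <= j)%N ->
  (i%:R / n%:R : R) <= j%:R / n%:R.
Proof. by move=> n0 ij; rewrite ler_pM2r ?invr_gt0 ?ltr0n// ler_nat. Qed.

Lemma grid_weight_ge0 (R : realFieldType) n k i : (0 < n)%N ->
  0 <= (i.+1%:R / n%:R : R) ^+ k - (i%:R / n%:R) ^+ k.
Proof.
by move=> n0; rewrite subr_ge0 lerXn2r ?nnegrE ?divr_ge0// grid_mono.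
Qed.

Lemma ray_sum_full (R : realFieldType) n k e N (x : R) : (0 < n)%N ->
  (N + e)%:R / n%:R < x ->
  ray_sum n k.+1 e N.+1 (fun t => (t < x)%R%:R) = (N.+1%:R / n%:R) ^+ k.+1.
Proof.
move=> n0 Nx; rewrite /ray_sum (eq_bigr (fun i : 'I_N.+1 =>
  (i.+1%:R / n%:R : R) ^+ k.+1 - (i%:R / n%:R) ^+ k.+1)); last first.
  move=> i _; rewrite (le_lt_trans _ Nx) ?mulr1// grid_mono// leq_add2r.
  by rewrite -ltnS.
rewrite -(big_mkord xpredT (fun i => (i.+1%:R / n%:R : R) ^+ k.+1 - (i%:R / n%:R) ^+ k.+1)).
by rewrite telescope_sumr// mul0r expr0n subr0.
Qed.

Lemma ray_sum_empty (R : realFieldType) n k e N (x : R) :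
  x <= (N + e)%:R / n%:R ->
  ray_sum n k e N.+1 (fun t => (t < x)%R%:R) = ray_sum n k e N (fun t => (t < x)%R%:R).
Proof. by move=> xN; rewrite /ray_sum big_ord_recr /= ltNge xN mulr0 addr0. Qed.

Lemma ray_sum_le (R : realFieldType) n k N (x : R) : (0 < n)%N -> 0 <= x ->
  ray_sum n k.+1 1 N (fun t => (t < x)%R%:R) <= x ^+ k.+1.
Proof.
move=> n0 x0; elim: N => [|N IH]; first by rewrite /ray_sum big_ord0 exprn_ge0.
have [Nx|xN] := ltP ((N + 1)%:R / n%:R) x; last by rewrite ray_sum_empty.
by rewrite ray_sum_full// lerXn2r ?nnegrE ?divr_ge0// -addn1 ltW.
Qed.

Lemma ray_sum_ge (R : realFieldType) n k N (x : R) : (0 < n)%N -> 0 <= x ->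
  x <= (N + 2)%:R / n%:R ->
  x ^+ k.+1 - k.+1%:R * x ^+ k * (2 / n%:R) <=
  ray_sum n k.+1 2 N (fun t => (t < x)%R%:R).
Proof.
move=> n0 x0; have nR : 0 < n%:R :> R by rewrite ltr0n.
elim: N => [|N IH] xN.
  rewrite /ray_sum big_ord0 subr_le0 exprSr -mulrA; rewrite add0n in xN.
  rewrite (le_trans (ler_wpM2l (exprn_ge0 _ x0) xN))//.
  by rewrite ler_peMl ?mulr_ge0 ?exprn_ge0 ?divr_ge0// ler1n.
have [Nx|xN'] := ltP ((N + 2)%:R / n%:R) x; last by rewrite ray_sum_empty// IH.
rewrite ray_sum_full// lerBlDr -lerBlDl.
have tx : N.+1%:R / n%:R <= x.
  by rewrite (le_trans _ (ltW Nx))// grid_mono//; lia.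
rewrite (le_trans (expr_diff_le _ _ tx)) ?divr_ge0//.
rewrite ler_wpM2l ?mulr_ge0 ?exprn_ge0// lerBlDr (le_trans xN)//.
by rewrite -mulrDl -natrD; apply: grid_mono => //; lia.
Qed.

(** Below the last jump the error is that of two steps of the grid; beyond it,
    [x ^ k.+2 / n] exceeds [x ^ k.+1] because [n < x]. *)
Lemma ray_sum_tail_ge (R : realFieldType) n k (x : R) : (0 < n)%N -> 0 <= x ->
  x ^+ k.+1 - k.+1%:R * x ^+ k * (2 / n%:R) - x ^+ k.+2 / n%:R <=
  ray_sum n k.+1 2 (n * n) (fun t => (t < x)%R%:R).
Proof.
move=> n0 x0; have nR : 0 < n%:R :> R by rewrite ltr0n.
have [xN|Nx] := leP x ((n * n + 2)%:R / n%:R).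
  by rewrite lerBlDr ler_wpDr ?ray_sum_ge// divr_ge0 ?exprn_ge0.
apply: (@le_trans _ _ 0); last first.
  by apply: sumr_ge0 => i _; rewrite mulr_ge0 ?grid_weight_ge0.
rewrite lerBlDr add0r lerBlDr ler_wpDr ?mulr_ge0 ?exprn_ge0 ?divr_ge0//.
rewrite (exprSr x k.+1) -mulrA ler_peMr ?exprn_ge0//.
rewrite ler_pdivlMr// mul1r (le_trans _ (ltW Nx))// ler_pdivlMr// -natrM ler_nat.
exact: leq_addr.
Qed.

Lemma ray_sum_shift_le (R : realFieldType) n k N (f g : R -> R) : (0 < n)%N ->
  (forall i, f (i.+2%:R / n%:R) <= g (i.+1%:R / n%:R)) ->
  ray_sum n k 2 N f <= ray_sum n k 1 N g.
Proof.
move=> n0 fg; apply: ler_sum => i _; rewrite addn1 addn2.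
by rewrite ler_wpM2l ?grid_weight_ge0.
Qed.

(** * Moments of the constructed measure *)

Lemma integral_ray_sum (R : realType) (rho : {measure set (measurableTypeR R) -> \bar R})
    n k N : (0 < n)%N ->
  (\int[rho]_(x in `[0%R, +oo[%classic)
     (ray_sum n k 1 N (fun t => (t < x)%R%:R))%:E =
   \sum_(i < N) ((i.+1%:R / n%:R) ^+ k - (i%:R / n%:R) ^+ k)%:E *
      rho `](i.+1%:R / n%:R)%R, +oo[%classic)%E.
Proof.
move=> n0; pose D : set (measurableTypeR R) := `[0, +oo[%classic.
have mD : measurable D by exact: measurable_itv.
pose ray i : set (measurableTypeR R) := `](i.+1%:R / n%:R), +oo[%classic.
have mray i : measurable (ray i) by exact: measurable_itv.
pose w i : R := (i.+1%:R / n%:R) ^+ k - (i%:R / n%:R) ^+ k.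
have w0 i : 0 <= w i by exact: grid_weight_ge0.
transitivity (\int[rho]_(x in D) (\sum_(i < N) (w i)%:E * (\1_(ray i) x)%:E))%E.
  apply: eq_integral => x _; rewrite -sumEFin; apply: eq_bigr => i _.
  rewrite -EFinM addn1 indicE; congr (_ * _%:R)%:E.
  by rewrite /ray mem_setE in_itv /= andbT.
rewrite ge0_integral_sum//.
- apply: eq_bigr => i _; rewrite ge0_integralZl_EFin//.
  + rewrite integral_indic// setIidl// => x; rewrite /ray /D /= !in_itv /= !andbT.
    by move=> /ltW; apply: le_trans; rewrite divr_ge0.
  + by apply/measurable_EFinP; exact: measurable_indic.
- move=> i; apply/measurable_EFinP; apply: measurable_funM => //.
- by move=> i x _; rewrite -EFinM lee_fin mulr_ge0.
Qed.

(** The step functions [g] with jumps at the nodes lie below the power, and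
    [h], which jumps one node later, is close to it. The tails of [rho] lie
    between the values of [S] at consecutive nodes, so the integral of [g] is
    squeezed between the values of the functional at [h] and at [g]. Fatou's
    lemma gives the upper bound in the limit. *)
Lemma tails_moments (R : realType) (L : {scalar {poly R}}) (S : R -> R)
    (rho : {measure set (measurableTypeR R) -> \bar R}) k :
  (forall (p : {poly R}) (s : seq (R * R)),
    (forall x, 0 <= x -> 0 <= p.[x] + \sum_(a <- s) a.1 * (a.2 < x)%R%:R) ->
    0 <= L p + \sum_(a <- s) a.1 * S a.2) ->
  (forall t, 0 <= t -> (rho `]t, +oo[%classic <= (S t)%:E)%E) ->
  (forall s t, 0 <= s -> s < t -> ((S t)%:E <= rho `]s, +oo[%classic)%E) ->
  (\int[rho]_(x in `[0%R, +oo[%classic) (x ^+ k.+1)%:E = (L 'X^(k.+1))%:E)%E.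
Proof.
move=> LS rS Sr; set I := (\int[rho]_(x in _) _)%E.
have mD : measurable (`[0, +oo[%classic : set (measurableTypeR R)).
  exact: measurable_itv.
pose N n := (n.+1 * n.+1)%N.
pose g n (x : R) := ray_sum n.+1 k.+1 1 (N n) (fun t => (t < x)%R%:R).
pose h n (x : R) := ray_sum n.+1 k.+1 2 (N n) (fun t => (t < x)%R%:R).
pose C x : R := k.+1%:R * x ^+ k * 2 + x ^+ k.+2.
have hg n x : h n x <= g n x.
  apply: ray_sum_shift_le => // i; rewrite ler_nat.
  case: ltP => // ix; rewrite (le_lt_trans _ ix)//.
  by rewrite ler_pM2r ?invr_gt0 ?ltr0n// ler_nat.
have hC n x : 0 <= x -> x ^+ k.+1 - C x / n.+1%:R <= h n x.
  move=> x0; have := @ray_sum_tail_ge _ n.+1 k x isT x0; apply: le_trans.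
  by rewrite /C mulrDl -!mulrA opprD addrA.
have gx n x : 0 <= x -> g n x <= x ^+ k.+1 by exact: ray_sum_le.
have g0 n x : 0 <= g n x.
  by apply: sumr_ge0 => i _; rewrite mulr_ge0 ?grid_weight_ge0.
pose pts c e n : seq (R * R) :=
  [seq (c * ((i.+1%:R / n.+1%:R : R) ^+ k.+1 - (i%:R / n.+1%:R) ^+ k.+1),
        (i + e)%:R / n.+1%:R : R) | i <- iota 0 (N n)].
have ptsE c e n f : \sum_(a <- pts c e n) a.1 * f a.2 =
    c * ray_sum n.+1 k.+1 e (N n) f.
  rewrite big_map /ray_sum mulr_sumr -(subn0 (N n)) -/(index_iota 0 _) big_mkord subn0.
  by apply: eq_bigr => i _; rewrite mulrA.
have SX n : ray_sum n.+1 k.+1 1 (N n) S <= L 'X^(k.+1).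
  rewrite -subr_ge0 -mulN1r -ptsE; apply: LS => x x0.
  by rewrite (ptsE _ _ _ (fun t => (t < x)%R%:R)) mulN1r hornerXn subr_ge0 gx.
pose CL := k.+1%:R * 2 * L 'X^k + L 'X^(k.+2).
have XS n : L 'X^(k.+1) - CL / n.+1%:R <= ray_sum n.+1 k.+1 2 (N n) S.
  pose p : {poly R} := n.+1%:R^-1 *: ((k.+1%:R * 2) *: 'X^k + 'X^(k.+2)) - 'X^(k.+1).
  have : 0 <= L p + \sum_(a <- pts 1 2 n) a.1 * S a.2.
    apply: LS => x x0; rewrite (ptsE _ _ _ (fun t => (t < x)%R%:R)) mul1r.
    rewrite /p !hornerE -lerBlDl sub0r opprB.
    rewrite (le_trans _ (hC n x x0))// /C lerB// le_eqVlt; apply/orP; left.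
    by apply/eqP; rewrite [RHS]mulrC mulrAC.
  rewrite ptsE mul1r linearB linearZ linearD linearZ /= -/CL -lerBlDl sub0r opprB.
  by rewrite (mulrC _ CL).
pose rr t : R := fine (rho `]t, +oo[%classic).
have rrE t : 0 <= t -> rho `]t, +oo[%classic = (rr t)%:E.
  move=> t0; rewrite /rr fineK// ge0_fin_numE//.
  by rewrite (le_lt_trans (rS t t0))// ltry.
have Ig n : (\int[rho]_(x in `[0%R, +oo[%classic) (g n x)%:E =
    (ray_sum n.+1 k.+1 1 (N n) rr)%:E)%E.
  rewrite /g integral_ray_sum// -sumEFin; apply: eq_bigr => i _.
  by rewrite addn1 rrE ?divr_ge0.
have IgX n : (\int[rho]_(x in `[0%R, +oo[%classic) (g n x)%:E <= (L 'X^(k.+1))%:E)%E.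
  rewrite Ig lee_fin (le_trans _ (SX n))//; apply: ler_sum => i _.
  rewrite ler_wpM2l ?grid_weight_ge0// -lee_fin -rrE ?divr_ge0//.
  by apply: rS; rewrite divr_ge0.
have XIg n : ((L 'X^(k.+1) - CL / n.+1%:R)%:E <=
    \int[rho]_(x in `[0%R, +oo[%classic) (g n x)%:E)%E.
  rewrite Ig lee_fin (le_trans (XS n))//; apply: ray_sum_shift_le => // i.
  rewrite -lee_fin -rrE ?divr_ge0//; apply: Sr; rewrite ?divr_ge0//.
  by rewrite ltr_pM2r ?invr_gt0 ?ltr0n// ltr_nat.
have mg n : measurable_fun (`[0, +oo[%classic : set (measurableTypeR R)) (g n).
  apply: measurable_sum => i; apply: measurable_funM => //.
  rewrite (_ : (fun _ => _) = \1_(`](i + 1)%:R / n.+1%:R, +oo[%classic : set R)).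
    by apply: measurable_indic; exact: measurable_itv.
  by apply/funext => x; rewrite indicE mem_setE in_itv /= andbT.
have mX : measurable_fun (`[0, +oo[%classic : set (measurableTypeR R))
   (fun x => x ^+ k.+1 : R).
  exact: measurable_funX.
apply/eqP; rewrite eq_le; apply/andP; split.
- pose G n x := (g n x)%:E.
  have -> : I = (\int[rho]_(x in `[0%R, +oo[%classic) limn_einf (G^~ x))%E.
    apply: eq_integral => x; rewrite inE /= in_itv /= andbT => x0.
    have /cvg_limn_einf_sup[-> _] // : G n x @[n --> \oo] --> (x ^+ k.+1)%:E.
    apply: cvg_EFin; first by near=> n.
    apply: (@squeeze_cvgr _ _ _ _ (fun n => x ^+ k.+1 - C x * harmonic n) (fun=> x ^+ k.+1)).
    + by near=> n; rewrite gx// andbT (le_trans (hC n x x0)).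
    + rewrite -[X in _ --> X]subr0 -[X in _ - X](mulr0 (C x)).
      by apply: cvgB; [exact: cvg_cst|apply: cvgMr; exact: cvg_harmonic].
    + exact: cvg_cst.
  apply: (le_trans (fatou _ _ _ _)) => //.
  + by move=> n; apply/measurable_EFinP.
  + by move=> n x _; rewrite lee_fin.
  + rewrite limn_einf_lim; apply: lime_le; first exact: is_cvg_einfs.
    near=> n; apply: (le_trans _ (IgX n)); apply: ereal_inf_lbound.
    by exists n => /=.
- apply/lee_addgt0Pr => e e0.
  pose n := Num.bound (`|CL| / e).
  have nCL : CL / n.+1%:R <= e.
    rewrite ler_pdivrMr// mulrC -ler_pdivrMr// (le_trans (ler_norm _))//.
    rewrite normrM (gtr0_norm (_ : 0 < e^-1)) ?invr_gt0//.
    by rewrite (le_trans (ltW (archi_boundP _)))// ?ler_nat ?leqnSn ?divr_ge0 ?(ltW e0).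
  apply: (@le_trans _ _ ((L 'X^(k.+1) - CL / n.+1%:R)%:E + e%:E)%E).
    by rewrite -EFinD lee_fin -addrA lerDl addrC subr_ge0.
  rewrite leeD2r// (le_trans (XIg n))//; apply: ge0_le_integral => //.
  + by move=> x _; rewrite lee_fin.
  + by apply/measurable_EFinP.
  + by apply/measurable_EFinP.
  + by move=> x; rewrite /= in_itv /= andbT => x0; rewrite lee_fin gx.
Unshelve. all: by end_near. Qed.

(** Stieltjes' theorem: the two families of determinants make the functional
    positive on squares and on ['X] times squares, hence on all polynomials
    that are nonnegative on the half line. *)
Lemma stieltjes_existence (R : realType) (m : nat -> R) :
  (forall k, (0 < k)%N -> 0 < \det (\matrix_(r < k, c < k) m (r + c)%N)) ->
  (forall k, (0 < k)%N -> 0 < \det (\matrix_(r < k, c < k) m (r + c + 1)%N)) ->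
  exists rho : {measure set (measurableTypeR R) -> \bar R}, represents rho m.
Proof.
move=> h0 h1; pose L : {scalar {poly R}} := [the {scalar {poly R}} of moment_functional m].
have sq_ge0 m' (f : {poly R}) :
    (forall k, (0 < k)%N -> 0 < \det (\matrix_(r < k, c < k) m' (r + c)%N)) ->
    0 <= moment_functional m' (f ^+ 2).
  move=> hm; have [->|f0] := eqVneq f 0; first by rewrite expr0n linear0.
  exact/ltW/moment_functional_sqr_gt0.
have L0 f : 0 <= L (f ^+ 2) by exact: sq_ge0.
have LX f : 0 <= L ('X * f ^+ 2).
  rewrite /L /= moment_functional_mulX; apply: sq_ge0 => k k0.
  have := h1 k k0; congr (0 < \det _).
  by apply/matrixP => i j; rewrite !mxE addn1.
have [S LS] := @tail_values _ L (fun p => halfline_functional_ge0 L0 LX).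
have L1 : L 1 = m 0%N by rewrite -[1]/(GRing.exp ('X : {poly R}) 0) /L /= moment_functionalXn.
have LX1 : L 'X = m 1%N by rewrite -['X]expr1 /L /= moment_functionalXn.
have S0 t : 0 <= S t <= m 0%N.
  apply/andP; split.
    have := LS 0 [:: (1, t)]; rewrite linear0 add0r big_seq1 mul1r; apply=> x _.
    by rewrite horner0 add0r big_seq1 mul1r.
  have := LS 1 [:: (-1, t)]; rewrite L1 big_seq1 mulN1r subr_ge0; apply=> x _.
  by rewrite hornerC big_seq1 mulN1r subr_ge0; case: (_ < _)%R.
have Sni : {homo S : s t / s <= t >-> t <= s}.
  move=> s t st; have := LS 0 [:: (1, s); (-1, t)].
  rewrite linear0 add0r big_cons big_seq1 mul1r mulN1r subr_ge0; apply=> x _.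
  rewrite horner0 add0r big_cons big_seq1 mul1r mulN1r subr_ge0 ler_nat.
  by case: (ltP t x) => // tx; rewrite (le_lt_trans st tx).
have St t : 0 <= t -> t * S t <= m 1%N.
  move=> t0; have := LS 'X [:: (- t, t)].
  rewrite LX1 big_seq1 mulNr subr_ge0; apply=> x x0.
  rewrite hornerX big_seq1 mulNr subr_ge0; case: (ltP t x) => [/ltW|_].
    by rewrite mulr1.
  by rewrite mulr0.
have [rho [rho0 rhoT rS Sr]] := measure_of_tails S0 Sni St.
exists rho; split=> // -[|k]; last first.
  by rewrite (tails_moments k LS rS Sr) /L /= moment_functionalXn.
under eq_integral do rewrite expr0.
rewrite integral_cst//.
rewrite mul1e -rhoT -(setUv (`]-oo, 0%R[%classic : set (measurableTypeR R))).
rewrite measureU//; [|exact: measurableC|exact: setICr].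
rewrite setCitvl -[LHS]add0e; congr (_ + _)%E.
exact/esym/rho0.
Qed.

(** * Integrals of polynomials and the support *)

Lemma represents_exprn_integrable (R : realType)
    (rho : {measure set (measurableTypeR R) -> \bar R}) (m : nat -> R) k :
  represents rho m ->
  rho.-integrable `[0%R, +oo[%classic (fun x => (x ^+ k)%:E).
Proof.
move=> [_ hm]; apply/integrableP; split.
  by apply/measurable_EFinP; exact: measurable_funX.
rewrite [ltLHS](_ : _ = (m k)%:E) ?ltry// -hm; apply: eq_integral => x.
rewrite inE /= in_itv /= andbT => x0.
by rewrite ger0_norm// exprn_ge0.
Qed.

Lemma represents_poly (R : realType)
    (rho : {measure set (measurableTypeR R) -> \bar R}) (m : nat -> R) (p : {poly R}) :
  represents rho m ->
  (\int[rho]_(x in `[0%R, +oo[%classic) (p.[x])%:E = (moment_functional m p)%:E)%E.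
Proof.
move=> hr; have mD : measurable (`[0, +oo[%classic : set (measurableTypeR R)).
  exact: measurable_itv.
have hm := hr.2.
transitivity (\int[rho]_(x in `[0%R, +oo[%classic)
    \sum_(i < size p) ((p`_i)%:E * (x ^+ i)%:E))%E.
  by apply: eq_integral => x _; rewrite horner_coef -sumEFin; apply: eq_bigr.
rewrite integral_sum// => [|i].
  rewrite /moment_functional -sumEFin; apply: eq_bigr => i _.
  by rewrite integralZl ?hm//; exact: represents_exprn_integrable hr.
by apply: integrableZl => //; exact: represents_exprn_integrable hr.
Qed.

(** Every point outside the support lies in a null interval with rational end
    points, and there are countably many of these. *)
Lemma support_complement_null (R : realType)
    (rho : {measure set (measurableTypeR R) -> \bar R}) :
  rho.-negligible (~` measure_support rho).
Proof.
pose J (q : rat * rat) : set (measurableTypeR R) := `]ratr q.1, ratr q.2[%classic.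
pose F n : set (measurableTypeR R) :=
  if unpickle n is Some q then (if rho (J q) == 0%E then J q else set0) else set0.
apply: (@negligibleS _ _ _ _ (\bigcup_n F n)); last first.
  apply: negligible_bigcup => n; rewrite /F.
  case: unpickle => [q|]; last exact: negligible_set0.
  case: eqP => [q0|_]; last exact: negligible_set0.
  by apply/negligibleP => //; exact: measurable_itv.
move=> x /existsNP[V /not_implyP[oV /not_implyP[Vx V0]]].
have /nbhs_ballP[e /= e0 eV] : nbhs x V by exact: open_nbhs_nbhs.
have [q1] := @rat_in_itvoo R (x - e) x (ltac:(by rewrite ltrBlDr ltrDl)).
rewrite in_itv /= => /andP[q1l q1r].
have [q2] := @rat_in_itvoo R x (x + e) (ltac:(by rewrite ltrDl)).
rewrite in_itv /= => /andP[q2l q2r].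
have FE : F (pickle (q1, q2)) = if rho (J (q1, q2)) == 0%E then J (q1, q2) else set0.
  by rewrite /F pickleK.
exists (pickle (q1, q2)); [exact: I|rewrite FE].
have IV : J (q1, q2) `<=` V.
  move=> y; rewrite /J /= in_itv /= => /andP[y1 y2]; apply: eV.
  rewrite /ball /= ltr_norml; apply/andP; split; lra.
have -> : rho (J (q1, q2)) == 0%E.
  rewrite eq_le measure_ge0 andbT.
  have : (rho (J (q1, q2)) <= rho V)%E.
    apply: le_measure; rewrite ?inE//; first exact: measurable_itv.
    exact: open_measurable.
  by move=> /le_trans; apply; rewrite leNgt; apply/negP.
by rewrite /J /= in_itv /= q1r q2l.
Qed.

(** A polynomial vanishing on a finite support would have a square of integral
    [0]. *)
Lemma represents_infinite_support (R : realType)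
    (rho : {measure set (measurableTypeR R) -> \bar R}) (m : nat -> R) :
  (forall p, p != 0 -> 0 < moment_functional m (p ^+ 2)) ->
  represents rho m -> infinite_set (measure_support rho).
Proof.
move=> m0 hr /finite_seqP[s sE].
pose p : {poly R} := \prod_(a <- s) ('X - a%:P).
have p0 : p != 0 by apply: monic_neq0; exact: monic_prod_XsubC.
have := m0 p p0; rewrite -lte_fin -(represents_poly _ hr).
rewrite (ae_eq_integral (cst 0%E)) ?integral0 ?ltxx//.
- apply/measurable_EFinP; apply: measurable_funTS.
  by apply: continuous_measurable_fun; exact: continuous_horner.
- apply: negligibleS (support_complement_null rho) => x /= nx sx; apply: nx => _ /=.
  rewrite horner_exp (_ : p.[x] = 0) ?expr0n//.
  by apply/eqP; rewrite -/(root p x) root_prod_XsubC; move: sx; rewrite sE.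
Qed.

(** * Polynomials approximating the indicator of an initial segment *)

Lemma cvg_natr_mul_expr (R : realType) (r : R) : 0 <= r < 1 ->
  n%:R * r ^+ n @[n --> \oo] --> 0.
Proof.
(* [n r^n = (n u^n) s^n] with [u] and [s] below [1], and [n u^n] is bounded. *)
move=> /andP[r0 r1]; pose s := (r + 1) / 2.
have s1 : s < 1 by rewrite /s; lra.
have s0 : 0 < s by rewrite /s; lra.
have rs : r < s by rewrite /s; lra.
pose u := r / s.
have u0 : 0 <= u by rewrite divr_ge0// ltW.
have u1 : u < 1 by rewrite /u ltr_pdivrMr// mul1r.
have bound n : n%:R * u ^+ n <= (1 - u)^-1.
  rewrite -[leRHS]mul1r ler_pdivlMr ?subr_gt0//.
  suff : n%:R * u ^+ n * (1 - u) <= 1 - u ^+ n.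
    by move=> /le_trans; apply; rewrite lerBlDr lerDl exprn_ge0.
  elim: n => [|n IH]; first by rewrite !mul0r expr0 subrr.
  have un1 : u ^+ n.+1 <= 1 by rewrite exprn_ile1// ltW.
  have h : 0 <= (1 - u) * (1 - u ^+ n.+1) by rewrite mulr_ge0 ?subr_ge0// ltW.
  have := ler_wpM2l u0 IH; move: h; rewrite -natr1 !exprS; nra.
have cs : (1 - u)^-1 * s ^+ n @[n --> \oo] --> 0.
  rewrite -[X in _ --> X](mulr0 (1 - u)^-1).
  by apply: cvgMr; apply: cvg_expr; rewrite ger0_norm// ltW.
apply: (@squeeze_cvgr _ _ _ _ (fun=> 0) (fun n => (1 - u)^-1 * s ^+ n)) => //;
  last exact: cvg_cst.
near=> n; rewrite mulr_ge0 ?exprn_ge0//=.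
have -> : r ^+ n = u ^+ n * s ^+ n by rewrite -exprMn /u divfK// gt_eqF.
by rewrite mulrA ler_wpM2r// exprn_ge0// ltW.
Unshelve. all: by end_near. Qed.

Lemma bernoulli_upper (R : realDomainType) (z : R) N : 0 <= z <= 1 ->
  1 - N%:R * z <= (1 - z) ^+ N.
Proof.
move=> /andP[z0 z1]; elim: N => [|N IH]; first by rewrite mul0r subr0 expr0.
have z1' : 0 <= 1 - z by rewrite subr_ge0.
have := ler_wpM2r z1' IH; rewrite -exprSr; apply: le_trans.
have : 0 <= N%:R * z * z by rewrite !mulr_ge0.
rewrite -natr1; nra.
Qed.

Lemma bernoulli_lower (R : realDomainType) (z : R) N : 0 <= z <= 1 ->
  (1 - z) ^+ N * (1 + N%:R * z) <= 1.
Proof.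
move=> /andP[z0 z1]; elim: N => [|N IH]; first by rewrite mul0r addr0 expr0 mulr1.
apply: le_trans IH; rewrite exprSr -mulrA ler_wpM2l ?exprn_ge0 ?subr_ge0//.
have : 0 <= N%:R * z * z by rewrite !mulr_ge0.
have : 0 <= z * z by rewrite mulr_ge0.
rewrite -natr1; nra.
Qed.

Definition cutoff_exponent (R : realType) (tau : R) n : nat :=
  (Num.truncn (n%:R / tau ^+ n)).+1.

(** The exponents [N] are chosen such that [N * y ^ n] tends to [0] for
    [y < tau] and to infinity for [tau <= y]; Bernoulli's inequality concludes
    on both sides. *)
Lemma cvg_cutoff (R : realType) (tau y : R) : 0 < tau <= 1 -> 0 <= y <= 1 ->
  (1 - y ^+ n) ^+ cutoff_exponent tau n @[n --> \oo] --> ((y < tau)%R%:R : R).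
Proof.
move=> /andP[tau0 tau1] /andP[y0 y1]; set N := cutoff_exponent tau.
have yn n : 0 <= y ^+ n <= 1 by rewrite exprn_ge0// exprn_ile1.
have tn n : 0 < tau ^+ n by rewrite exprn_gt0.
have Ngt n : n%:R / tau ^+ n < (N n)%:R by exact: truncnS_gt.
have Nle n : (N n)%:R <= n%:R / tau ^+ n + 1.
  have h : 0 <= n%:R / tau ^+ n by rewrite divr_ge0// ltW.
  by rewrite /N /cutoff_exponent -natr1 lerD2r; have /andP[] := truncn_itv h.
have p0 n : 0 <= (1 - y ^+ n) ^+ N n.
  by rewrite exprn_ge0// subr_ge0; case/andP: (yn n).
have p1 n : (1 - y ^+ n) ^+ N n <= 1.
  rewrite exprn_ile1// ?subr_ge0; case/andP: (yn n) => // ? _.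
  by rewrite lerBlDr lerDl.
case: ltP => [yt|ty].
  have r1 : 0 <= y / tau < 1 by rewrite divr_ge0 ?(ltW tau0)//= ltr_pdivrMr// mul1r.
  pose low n := 1 - (n%:R * (y / tau) ^+ n + y ^+ n).
  have low1 : low n @[n --> \oo] --> (1 : R).
    rewrite -[X in _ --> X]subr0 -[X in _ - X]addr0.
    apply: cvgB; first exact: cvg_cst.
    apply: cvgD; first exact: cvg_natr_mul_expr.
    by apply: cvg_expr; rewrite ger0_norm// (lt_le_trans yt).
  apply: (@squeeze_cvgr _ _ _ _ low (fun=> 1)) => //; last exact: cvg_cst.
  near=> n; rewrite p1 andbT; apply: le_trans (bernoulli_upper _ (yn n)).
  rewrite /low lerB//; have /andP[yn0 _] := yn n.
  apply: le_trans (ler_wpM2r yn0 (Nle n)) _.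
  by rewrite mulrDl mul1r expr_div_n mulrAC mulrA.
apply: (@squeeze_cvgr _ _ _ _ (fun=> 0) harmonic); last exact: cvg_harmonic.
  near=> n; rewrite p0 /harmonic /= -[leRHS]mul1r ler_pdivlMr//.
  apply: le_trans (bernoulli_lower (N n) (yn n)); rewrite ler_wpM2l//.
  rewrite -natr1 addrC lerD2l.
  have : tau ^+ n <= y ^+ n by rewrite lerXn2r ?nnegrE// ltW.
  move/(ler_wpM2l (ler0n R (N n))); apply: le_trans.
  by rewrite -ler_pdivrMr// ltW.
exact: cvg_cst.
Unshelve. all: by end_near. Qed.

(** * Compact support and uniqueness *)

Lemma wact_bound (R : realDomainType) (s : seq (bidiag R)) (C K : R) (x : nat -> R) :
  1 <= C -> coeffs_in (fun c => `|c| <= C) s -> (forall i, `|x i| <= K) ->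
  forall i, `|wact s x i| <= (1 + C) ^+ size s * K.
Proof.
move=> C1 + xK; elim: s => [_ i|F s IH]; first by rewrite expr0 mul1r.
rewrite coeffs_in_cons => -[CF Cs] i /=; rewrite exprS -mulrA.
have K0 : 0 <= (1 + C) ^+ size s * K.
  by rewrite mulr_ge0 ?exprn_ge0 ?(le_trans _ (xK 0%N))//; lra.
have {}IH := IH Cs.
have pair c j l : `|c| <= C ->
    `|wact s x j + c * wact s x l| <= (1 + C) * ((1 + C) ^+ size s * K).
  move=> cC; rewrite (le_trans (ler_normD _ _))// mulrDl mul1r lerD ?IH//.
  by rewrite normrM ler_pM.
case: F CF => [l|u] CF /=; last by rewrite addrC; exact: pair.
case: i => [|i]; last exact: pair.
have := pair 0 0%N 0%N; rewrite mul0r addr0 normr0; apply; lra.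
Qed.

Lemma moment_bound (R : realDomainType) (s : seq (bidiag R)) a b (C : R) :
  1 <= C -> coeffs_in (fun c => `|c| <= C) s ->
  exists D B : R, [/\ 0 <= D, 0 <= B & forall k, `|moment s a b k| <= D * B ^+ k].
Proof.
move=> C1 Cs; have C0 : 0 <= 1 + C by lra.
exists ((1 + C) ^+ size (take (cyclic_dist (size s) a b) (rot a.-1 s))).
exists ((1 + C) ^+ size s); split; rewrite ?exprn_ge0// => k.
rewrite moment_wact; apply: wact_bound => //.
  by apply: coeffs_in_take; exact: coeffs_in_rot.
elim: k => [|k IH] i; first by rewrite expr0 /= /e0; case: eqP; rewrite ?normr1 ?normr0.
rewrite exprS iterS -{1}(size_rot b.-1 s); apply: wact_bound => //.
exact: coeffs_in_rot.
Qed.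

(** Chebyshev's inequality for all the powers at once. *)
Lemma represents_bounded (R : realType)
    (rho : {measure set (measurableTypeR R) -> \bar R}) (m : nat -> R) (D B b : R) :
  represents rho m -> 0 <= D -> 0 <= B -> (forall k, `|m k| <= D * B ^+ k) ->
  B < b -> rho `]b, +oo[%classic = 0%E.
Proof.
move=> [_ hm] D0 B0 mB Bb; have b0 : 0 < b by exact: le_lt_trans Bb.
pose A : set (measurableTypeR R) := `]b, +oo[%classic.
have mA : measurable A by exact: measurable_itv.
have mD : measurable (`[0, +oo[%classic : set (measurableTypeR R)).
  exact: measurable_itv.
have AD : A `<=` `[0, +oo[%classic.
  move=> x; rewrite /A /= !in_itv /= !andbT => bx.
  by rewrite ltW// (lt_trans b0).
have h k : ((b ^+ k)%:E * rho A <= (D * B ^+ k)%:E)%E.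
  apply: (@le_trans _ _ (m k)%:E); last first.
    by rewrite lee_fin (le_trans (ler_norm _)).
  rewrite -hm -(integral_cst rho mA).
  apply: (@le_trans _ _ (\int[rho]_(x in A) (x ^+ k)%:E)%E).
    apply: ge0_le_integral => //.
    - by move=> x _; rewrite lee_fin exprn_ge0// ltW.
    - by apply/measurable_EFinP; exact: measurable_funX.
    - move=> x; rewrite /A /= in_itv /= andbT => bx.
      by rewrite lee_fin lerXn2r ?nnegrE ?ltW// (lt_trans b0).
  apply: ge0_subset_integral => //.
  - by apply/measurable_EFinP; exact: measurable_funX.
  - by move=> x; rewrite /= in_itv /= andbT => x0; rewrite lee_fin exprn_ge0.
have fA : rho A \is a fin_num.
  rewrite ge0_fin_numE//; apply: (le_lt_trans _ (ltry (D * B ^+ 0))).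
  by have := h 0%N; rewrite !expr0 mul1e.
apply/eqP; rewrite eq_le measure_ge0 andbT -(fineK fA) lee_fin.
have hf k : fine (rho A) <= D * (B / b) ^+ k.
  have := h k; rewrite -(fineK fA) -EFinM lee_fin mulrC -ler_pdivlMr ?exprn_gt0//.
  by rewrite expr_div_n mulrA.
have : D * (B / b) ^+ k @[k --> \oo] --> (0 : R).
  rewrite -[X in _ --> X](mulr0 D); apply: cvgMr; apply: cvg_expr.
  by rewrite ger0_norm ?divr_ge0 ?(ltW b0)// ltr_pdivrMr// mul1r.
by move/cvgr_to_ge; apply; near=> k; exact: hf.
Unshelve. all: by end_near. Qed.

Lemma bounded_support_compact (R : realType)
    (rho : {measure set (measurableTypeR R) -> \bar R}) (b : R) :
  rho `]-oo, 0%R[%classic = 0%E -> (forall c, b < c -> rho `]c, +oo[%classic = 0%E) ->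
  compact (measure_support rho).
Proof.
move=> rho0 rhob; apply: (@subclosed_compact _ _ (`[0, b]%classic : set R)).
- move=> x cx V oV Vx; have [y [hy Vy]] := cx V (open_nbhs_nbhs (conj oV Vx)).
  exact: hy.
- exact: segment_compact.
- move=> x hx; rewrite /= in_itv /=; apply/andP; split; rewrite leNgt; apply/negP => xb.
    have := hx `]-oo, 0[%classic (interval_open _ _); rewrite rho0 ltxx.
    by move=> h; have : false by apply: h => //=; rewrite in_itv.
  pose c := (b + x) / 2; have bc : b < c by rewrite /c; lra.
  have cx : c < x by rewrite /c; lra.
  have := hx `]c, +oo[%classic (interval_open _ _); rewrite rhob// ltxx.
  by move=> h; have : false by apply: h => //=; rewrite in_itv /= cx.
Qed.

Definition cutoff_poly (R : realType) (b tau : R) n : {poly R} :=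
  (1 - (b^-1 *: 'X) ^+ n) ^+ cutoff_exponent tau n.

(** On the interval from [0] to [b], which carries the measure, the cutoff
    polynomials are bounded by [1] and tend to the indicator of the points
    below [t]. Their integrals are determined by the moments. *)
Lemma represents_ray_cvg (R : realType)
    (rho : {measure set (measurableTypeR R) -> \bar R}) (m : nat -> R) (b t : R) :
  represents rho m -> 0 < t -> t <= b -> rho `]b, +oo[%classic = 0%E ->
  (moment_functional m (cutoff_poly b (t / b) n))%:E @[n --> \oo] -->
    rho `]-oo, t[%classic.
Proof.
move=> hr t0 tb rhob; have b0 : 0 < b by exact: lt_le_trans tb.
have mD : measurable (`[0, +oo[%classic : set (measurableTypeR R)).
  exact: measurable_itv.
pose A : set (measurableTypeR R) := `]-oo, t[%classic.
have mA : measurable A by exact: measurable_itv.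
have -> : rho `]-oo, t[%classic =
    (\int[rho]_(x in `[0%R, +oo[%classic) (\1_A x)%:E)%E.
  rewrite integral_indic// -/A (measureDI rho mA mD).
  rewrite [X in (X + _)%E](_ : _ = 0%E) ?add0e//.
  apply: (subset_measure0 _ _ _ hr.1); [exact: measurableD|exact: measurable_itv|].
  by move=> x [_ /=]; rewrite !in_itv /= andbT => /negP; rewrite -ltNge.
under eq_fun => n do rewrite -(represents_poly _ hr).
pose f n (x : R) : \bar R := ((cutoff_poly b (t / b) n).[x])%:E.
have nb : rho.-negligible `]b, +oo[%classic.
  by apply/negligibleP => //; exact: measurable_itv.
have pE n x : (cutoff_poly b (t / b) n).[x] =
    (1 - (x / b) ^+ n) ^+ cutoff_exponent (t / b) n.
  by rewrite /cutoff_poly horner_exp hornerD hornerN horner_exp hornerZ hornerX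
    hornerC mulrC.
have xb1 x : 0 <= x -> x <= b -> 0 <= x / b <= 1.
  by move=> x0 xb; rewrite divr_ge0 ?(ltW b0)//= ler_pdivrMr// mul1r.
have tb1 : 0 < t / b <= 1 by rewrite divr_gt0//= ler_pdivrMr// mul1r.
have i1 : rho.-integrable `[0%R, +oo[%classic (cst 1%E).
  rewrite (_ : cst 1%E = fun x : R => (x ^+ 0)%:E); last first.
    by apply/funext => x; rewrite expr0.
  exact: represents_exprn_integrable hr.
have [] := @dominated_convergence _ _ _ rho _ mD f
  (fun x => (\1_A x)%:E) (cst 1%E) _ _ _ i1 _ => //.
- move=> n; apply/measurable_EFinP; apply: measurable_funTS.
  by apply: continuous_measurable_fun; exact: continuous_horner.
- by apply/measurable_EFinP; exact: measurable_indic.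
- apply: (negligibleS _ nb) => x /= h.
  rewrite in_itv /= andbT ltNge; apply/negP => xb; apply: h.
  rewrite in_itv /= andbT => x0; apply: cvg_EFin; first by near=> n.
  rewrite /f /= indicE mem_setE in_itv /= -(ltr_pM2r (_ : 0 < b^-1)) ?invr_gt0//.
  under eq_fun do rewrite pE.
  by apply: cvg_cutoff => //; exact: xb1.
- apply: (negligibleS _ nb) => x /= h.
  rewrite in_itv /= andbT ltNge; apply/negP => xb; apply: h => n.
  rewrite in_itv /= andbT => x0; rewrite lee_fin pE.
  have /andP[z0 z1] := xb1 x x0 xb.
  have zn : 0 <= 1 - (x / b) ^+ n by rewrite subr_ge0 exprn_ile1.
  rewrite ger0_norm ?exprn_ge0// exprn_ile1//.
  by rewrite lerBlDr lerDl exprn_ge0.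
Unshelve. all: by end_near. Qed.

Lemma represents_unique (R : realType)
    (rho1 rho2 : {measure set (measurableTypeR R) -> \bar R}) (m : nat -> R) (b : R) :
  represents rho1 m -> represents rho2 m ->
  (forall c, b < c -> rho1 `]c, +oo[%classic = 0%E) ->
  (forall c, b < c -> rho2 `]c, +oo[%classic = 0%E) ->
  forall X : set (measurableTypeR R), measurable X -> rho1 X = rho2 X.
Proof.
move=> hr1 hr2 b1 b2.
have ray t : rho1 `]-oo, t[%classic = rho2 `]-oo, t[%classic.
  have [t0|t0] := leP t 0.
    have z (rho : {measure set (measurableTypeR R) -> \bar R}) :
        rho `]-oo, 0%R[%classic = 0%E -> rho `]-oo, t[%classic = 0%E.
      move=> h; apply: (subset_measure0 _ _ _ h); [exact: measurable_itv..|].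
      by move=> x; rewrite /= !in_itv /= => /lt_le_trans; apply.
    by rewrite (z _ hr1.1) (z _ hr2.1).
  (* Beyond [b] to carry the mass, and at least [t] for the threshold [t / c]. *)
  pose c := Num.max (b + 1) t.
  have tc : t <= c by rewrite le_max lexx orbT.
  have bc : b < c by rewrite lt_max ltrDl ltr01.
  have h1 := represents_ray_cvg hr1 t0 tc (b1 _ bc).
  have h2 := represents_ray_cvg hr2 t0 tc (b2 _ bc).
  exact: cvg_unique h1 h2.
have fin1 t : (rho1 `]-oo, t[%classic < +oo)%E.
  have mD : measurable (`[0, +oo[%classic : set (measurableTypeR R)).
    exact: measurable_itv.
  have mA : measurable (`]-oo, t[%classic : set (measurableTypeR R)).
    exact: measurable_itv.
  have fD : (rho1 `[0%R, +oo[%classic < +oo)%E.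
    have := hr1.2 0%N; under eq_integral do rewrite expr0.
    by rewrite integral_cst// mul1e => ->; exact: ltry.
  rewrite (measureDI rho1 mA mD) [X in (X + _)%E](_ : _ = 0%E) ?add0e.
    apply: le_lt_trans fD; apply: le_measure; rewrite ?inE//; exact: measurableI.
  apply: (subset_measure0 _ _ _ hr1.1); [exact: measurableD|exact: measurable_itv|].
  by move=> x [_ /=]; rewrite !in_itv /= andbT => /negP; rewrite -ltNge.
move=> X mX; apply: (@measure_unique _ _ (measurableTypeR R) (@RGenInftyO.G R)
  (fun n => `]-oo, n%:R[%classic) _ _ _ _ rho1 rho2) => //.
- exact: RGenInftyO.measurableE.
- move=> _ _ [x ->] [y ->]; exists (Num.min x y); apply/seteqP; split=> z /=.
    by rewrite !in_itv /= lt_min => -[-> ->].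
  by rewrite !in_itv /= lt_min => /andP[].
- by move=> n; exists n%:R.
- rewrite -subTset => x _; exists (Num.truncn x).+1 => //=.
  by rewrite in_itv /=; exact: truncnS_gt.
- by move=> _ [t ->]; exact: ray.
Qed.

(** * The Hankel matrices of the refactorized factors *)

Theorem theorem6p2 (R : realType) (p q : nat) (hp : (0 < p)%N) (hq : (0 < q)%N)
    (T : smatrix R) (L : 'I_p -> nat -> R) (U : 'I_q -> nat -> R)
    (hT : positive_bidiagonal_factorization T L U)
    (a0 : nat) (ha0 : (a_minus p q <= a0 <= a_plus p q)%N)
    (Ft : seq (bidiag R)) (hFt : refactorized L U a0 Ft)
    (a b : nat) (ha : (1 <= a <= p + q)%N) (hb : (1 <= b <= p + q)%N) :
  (* the polynomial does not depend on the ring nor on the factors: the identity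
     holds for all factor lists with the type word of Ft, in particular for Ft *)
  (forall (k : nat) (r c : 'I_k -> nat),
     {homo r : i j / (i < j)%N} -> {homo c : i j / (i < j)%N} ->
     exists (N : nat) (v : 'I_N -> 'I_(p + q) * nat) (Q : mpoly.mpoly N int),
       nonneg_coefs Q /\
       forall (A : comNzRingType) (s : seq (bidiag A)),
         type_word s = sigma_min p q ->
         hankel_minor (moment s a b) r c = eval_coefs v Q s) /\
  (forall k : nat, (0 < k)%N ->
     0 < \det (\matrix_(r < k, c < k) moment Ft a b (r + c)%N) /\
     0 < \det (\matrix_(r < k, c < k) moment Ft a b (r + c + 1)%N)) /\
  (exists rho : {measure set (measurableTypeR R) -> \bar R},
     represents rho (moment Ft a b) /\ infinite_set (measure_support rho)) /\
  (bounded_coefs Ft ->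
     (forall rho : {measure set (measurableTypeR R) -> \bar R},
        represents rho (moment Ft a b) -> compact (measure_support rho)) /\
     (forall rho1 rho2 : {measure set (measurableTypeR R) -> \bar R},
        represents rho1 (moment Ft a b) -> represents rho2 (moment Ft a b) ->
        forall B : set (measurableTypeR R), measurable B -> rho1 B = rho2 B)).
Proof.
have [CF FL FU sF] := refactorized_positive hp hq hT hFt.
have detF e k : 0 < \det (\matrix_(r < k, c < k) moment Ft a b (r + (e + c))%N).
  by apply: hankel_det_gt0 => //; rewrite sF.
have det0 k : (0 < k)%N -> 0 < \det (\matrix_(r < k, c < k) moment Ft a b (r + c)%N).
  by move=> _; exact: (detF 0%N).
have det1 k : (0 < k)%N ->
    0 < \det (\matrix_(r < k, c < k) moment Ft a b (r + c + 1)%N).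
  move=> _; have := detF 1%N k; congr (0 < \det _).
  by apply/matrixP => i j; rewrite !mxE add1n addnS addn1.
split=> [k r c hr hc|].
  have sw : size (sigma_min p q) = (p + q)%N by rewrite size_mkseq.
  have := @hankel_minor_polynomial (sigma_min p q) a b k r c.
  by rewrite sw; exact.
split=> [k k0|]; first by split; [exact: det0|exact: det1].
split=> [|[C hC]].
  have [rho hr] := stieltjes_existence det0 det1; exists rho; split=> //.
  apply: (represents_infinite_support _ hr) => f f0.
  exact: moment_functional_sqr_gt0.
have [D [B [D0 B0 mB]]] : exists D B : R, [/\ 0 <= D, 0 <= B &
    forall k, `|moment Ft a b k| <= D * B ^+ k].
  apply: (@moment_bound _ _ _ _ (Num.max 1 C)); first by rewrite le_max lexx.
  by move=> i n iF; rewrite le_max hC// orbT.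
have tail (rho : {measure set (measurableTypeR R) -> \bar R}) :
    represents rho (moment Ft a b) ->
    forall c, B < c -> rho `]c, +oo[%classic = 0%E.
  by move=> hr c Bc; exact: represents_bounded hr D0 B0 mB Bc.
split=> [rho hr|rho1 rho2 hr1 hr2].
  exact: (bounded_support_compact hr.1 (tail _ hr)).
exact: (represents_unique hr1 hr2 (tail _ hr1) (tail _ hr2)).
Qed.
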